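(* If a $4$-web $NW$ (a $4$-web with a constant basic invariant and equal curvature forms of its $3$-subwebs) is linearizable, then it is parallelizable.
   Context: Let $M^2$ be a two-dimensional analytic manifold. A $4$-web is given in an open domain $D\subset M^2$ by four foliations $X_1,X_2,X_3,X_4$ of curves such that the tangents to the curves of different foliations through any point of $D$ are distinct, and two curves of different foliations have at most one common point in $D$. All functions and forms are real of class $C^\infty$ (or holomorphic in the complex case). All considerations are local ($D$ may be shrunk around a point). The foliation $X_\alpha$, $\alpha=1,2,3$, is defined by $\omega_\alpha=0$, where the $1$-forms are normalized so that $\omega_1+\omega_2+\omega_3=0$. There is a unique $1$-form $\theta$ with $d\omega_\alpha=\omega_\alpha\wedge\theta$, and the curvature $K$ of the $3$-subweb $[1,2,3]$ is defined by $d\theta=K\,\omega_1\wedge\omega_2$. The foliation $X_4$ is defined by $\omega_4=0$, where $-\omega_4=a\omega_1+\omega_2$; the function $a\neq0,1$ is the basic invariant (it equals the cross-ratio of the four tangents to the leaves of $X_2,X_1,X_3,X_4$ through a point), and $da=a_1\omega_1+a_2\omega_2$. A web $NW$ is a $4$-web with a constant basic invariant ($a_1=a_2=0$) and equal curvature forms of its four $3$-subwebs (when $a_1=a_2=0$ all four curvature forms automatically equal $K\,\omega_1\wedge\omega_2$). Two $4$-webs with domains $D,\widetilde D$ are equivalent if there is a diffeomorphism (respectively an analytic isomorphism) $\phi:D\to\widetilde D$ with $\phi(X_c)=\widetilde X_c$, $c=1,2,3,4$. A $4$-web is linear if it is formed by four foliations of straight lines, and linearizable if it is equivalent to a linear $4$-web.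 It is parallel if it is formed by four foliations of parallel straight lines in an affine plane, and parallelizable if it is equivalent to a parallel $4$-web. *)

(* Defs.v *)
From HB Require Import structures.
From mathcomp Require Import all_boot all_order all_algebra.
From mathcomp Require Import complex.
From mathcomp Require Import all_classical all_reals all_analysis.

Set Implicit Arguments.
Unset Strict Implicit.
Unset Printing Implicit Defensive.

Import Order.TTheory GRing.Theory Num.Theory.
Import numFieldNormedType.Exports.

Local Open Scope classical_set_scope.
Local Open Scope ring_scope.

Variant ground_field := RealField | ComplexField.

Definition base_field (R : realType) (k : ground_field) : numFieldType :=
  match k with
  | RealField => R
  | ComplexField => complex R
  end.

Section Smooth.
Variables (K : numFieldType) (V W : normedModType K).

(* Derivatives are taken over K.  For open U and finite-dimensional V, smooth U
   is C^oo on U if K is a real field, and holomorphic on U if K is complex. *)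
Fixpoint smooth_upto (n : nat) (U : set V) (f : V -> W) : Prop :=
  if n is n'.+1 then
    (forall p, U p -> differentiable f p) /\
    (forall v, smooth_upto n' U ('D_v f))
  else forall p, U p -> {for p, continuous f}.

Definition smooth (U : set V) (f : V -> W) : Prop :=
  forall n, smooth_upto n U f.

End Smooth.

Notation plane K := (K * K)%type.

Section Forms.
Variable K : numFieldType.
Implicit Types (D : set (plane K)) (f : plane K -> K).

(* The pair (a, b) stands for the 1-form a dx + b dy, and a 2-form is given by
   its coefficient at dx /\ dy. *)
Definition one_form : Type := plane K -> K * K.
Definition two_form : Type := plane K -> K.

Implicit Types w t : one_form.

Definition pairing w (p v : plane K) : K := (w p).1 * v.1 + (w p).2 * v.2.

Definition wedge w t : two_form :=
  fun p => (w p).1 * (t p).2 - (w p).2 * (t p).1.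

Definition ext_d w : two_form :=
  fun p => 'D_(1, 0) (fun q => (w q).2) p - 'D_(0, 1) (fun q => (w q).1) p.

End Forms.

Section Webs.
Variable K : numFieldType.
Implicit Types (D U V L : set (plane K)) (F : set (set (plane K))).

(* For K complex this is an analytic isomorphism. *)
Definition diffeo U V (h : plane K -> plane K) : Prop :=
  [/\ set_bij U V h, smooth U h &
      exists2 g, smooth V g & forall p, U p -> g (h p) = p].

(* In U the leaves are the curves y = const of the chart h; a leaf may meet U in
   several of them, one for each connected component. *)
Definition flow_box F U (h : plane K -> plane K) : Prop :=
  forall L q, F L -> L q -> U q ->
    connected_component (L `&` U) q = [set r | U r /\ (h r).2 = (h q).2].

(* A foliation is given by the set of its leaves. *)
Definition foliation D F : Prop :=
  [/\ partition F id D,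
      forall L, F L -> connected L &
      forall p, D p -> exists U V h,
        [/\ open U, open V, U p & U `<=` D] /\
        (diffeo U V h /\ flow_box F U h)].

Definition tangent L (p : plane K) : set (plane K) :=
  [set v | exists (I : set K) (g : K -> plane K),
    [/\ open I, I 0 & smooth I g] /\
    [/\ g @` I `<=` L, g 0 = p & derive1 g 0 = v]].

Definition web4 D (X : 'I_4 -> set (set (plane K))) : Prop :=
  [/\ open D, connected D, forall c, foliation D (X c),
      forall c d L M p, c != d -> X c L -> X d M -> L p -> M p ->
        tangent L p <> tangent M p &
      forall c d L M, c != d -> X c L -> X d M -> is_subset1 (L `&` M)].

Definition defined_by D F (w : one_form K) : Prop :=
  smooth D w /\
  forall L p, F L -> L p -> tangent L p = [set v | pairing w p v = 0].

Definition normalized_forms D (X : 'I_3 -> set (set (plane K)))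
    (w : 'I_3 -> one_form K) : Prop :=
  (forall i, defined_by D (X i) (w i)) /\
  (forall p, D p -> \sum_(i < 3) w i p = 0).

Definition connection_form D (w : 'I_3 -> one_form K) (t : one_form K) : Prop :=
  smooth D t /\ forall i p, D p -> ext_d (w i) p = wedge (w i) t p.

(* d t = K w_1 /\ w_2.  The connection form t depends on the normalized forms,
   but d t does not: multiplying all w i by a function u changes t by - du / u. *)
Definition curvature_form D (X : 'I_3 -> set (set (plane K)))
    (Om : two_form K) : Prop :=
  exists w t, [/\ normalized_forms D X w, connection_form D w t &
    forall p, D p -> Om p = ext_d t p].

(* The foliations X_1, ..., X_4 are numbered from 0, and [subweb X c] is the
   3-web obtained by omitting X c. *)
Definition subweb (X : 'I_4 -> set (set (plane K))) (c : 'I_4) :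
    'I_3 -> set (set (plane K)) := fun i => X (lift c i).

Definition basic_invariant D (X : 'I_4 -> set (set (plane K)))
    (a : plane K -> K) : Prop :=
  exists (w : 'I_3 -> one_form K) (w4 : one_form K),
    [/\ normalized_forms D (subweb X ord_max) w,
        defined_by D (X ord_max) w4 &
        forall p, D p -> - w4 p = a p *: w 0 p + w 1 p].

Definition webNW D (X : 'I_4 -> set (set (plane K))) : Prop :=
  [/\ web4 D X,
      exists a : K, basic_invariant D X (fun=> a) &
      exists Om : two_form K, forall c, curvature_form D (subweb X c) Om].

Definition equivalent_webs D (X : 'I_4 -> set (set (plane K)))
    D' (X' : 'I_4 -> set (set (plane K))) : Prop :=
  exists phi, diffeo D D' phi /\ forall c, X' c = (fun L => phi @` L) @` X c.

Definition line (p v : plane K) : set (plane K) :=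
  [set q | exists s : K, q = p + s *: v].

Definition linear_web (X : 'I_4 -> set (set (plane K))) : Prop :=
  forall c L, X c L -> exists p v, v != 0 /\ L `<=` line p v.

Definition parallel_web (X : 'I_4 -> set (set (plane K))) : Prop :=
  forall c, exists2 v, v != 0 & forall L, X c L -> exists p, L `<=` line p v.

Definition linearizable D (X : 'I_4 -> set (set (plane K))) : Prop :=
  exists D' X', [/\ web4 D' X', linear_web X' & equivalent_webs D X D' X'].

Definition parallelizable D (X : 'I_4 -> set (set (plane K))) : Prop :=
  exists D' X', [/\ web4 D' X', parallel_web X' & equivalent_webs D X D' X'].

End Webs.

(* Main.v *)
(** Let w0, w1 be the normalized forms of the first two foliations, transported
    to the domain of the linear web.  The leaves of w = 0 are straight when
    D_v w(v) = 0 for v in the kernel of w.  For w = x w0 + y w1 this expression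
    is a binary cubic form in (x, y), and a linear web with constant basic
    invariant a provides four roots (1, 0), (0, 1), (1, 1), (a, 1), so the form
    vanishes: d_i w_j = l_i w_j + p_j w_i for w = w0, w1 and two common 1-forms
    l, p.  Comparing second derivatives gives d_i p_j = p_i p_j up to a skew term
    F = dl, then d_i F = 3 p_i F, and finally F ^ 2 = 0.  Now d_i p_j = p_i p_j
    says that the line with homogeneous coordinates (p, 1 + p(q - o)) does not
    depend on q; this line misses the domain, and the projective transformation
    which sends it to infinity turns the linear web into a parallel one. *)

Require Import Defs.
From HB Require Import structures.
From mathcomp Require Import all_boot all_order all_algebra.
From mathcomp Require Import complex ring.
From mathcomp Require Import all_classical all_reals all_analysis.

Set Implicit Arguments.
Unset Strict Implicit.
Unset Printing Implicit Defensive.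

Import Order.TTheory GRing.Theory Num.Theory.
Import numFieldNormedType.Exports.

Local Open Scope classical_set_scope.
Local Open Scope ring_scope.

(** * Smooth maps *)

(** Both ground fields are served by one argument over [K]. There is no mean value theorem for
    complex-valued functions, so [real_parts] cuts a [K]-differentiable function into real
    components along real segments. This yields the two analytic facts that the algebra consumes:
    mixed derivatives agree, and vanishing derivatives force local constancy. Geometrically, the
    leaf through q lies on the line with homogeneous coordinates (w(q), - w(q)(q - o)). The system
    d_i w_j = l_i w_j + p_j w_i says that this line moves inside the pencil that it spans with the
    line p(q)(z - q) = 1. Since the latter turns out to be fixed, every foliation is a pencil of
    lines with its vertex on that one line, and sending it to infinity makes the lines of each
    pencil parallel. The fixed line is determined only through ratios of coordinates, any one of
    which may vanish somewhere, and the domain is connected but perhaps not convex. Its constancy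
    therefore comes from an open-and-closed argument on ratios, not from integration along a
    segment. *)

Section SmoothMaps.
Variables (K : numFieldType) (V W : normedModType K).
Implicit Types (n : nat) (U : set V) (f g : V -> W).

Lemma derive_eq_on U f g v : open U -> (forall p, U p -> f p = g p) ->
  forall p, U p -> 'D_v f p = 'D_v g p.
Proof.
move=> oU fg p Up; apply: near_eq_derive.
by apply: filterS (open_nbhs_nbhs (conj oU Up)) => q; exact: fg.
Qed.

(** The first-order expansion of [f] at [p] only involves nearby points, so it is also one of [g],
    and [diff_unique] identifies the differentials. *)
Lemma differentiable_eq_on U f g p : open U -> (forall p, U p -> f p = g p) ->
  U p -> differentiable f p -> differentiable g p.
Proof.
move=> oU fg Up /diff_locallyP[cdf df].
have dg : g \o shift p = cst (g p) + 'd f p +o_ 0 id.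
  apply/eqaddoP => e e0; move/eqaddoP/(_ e e0) : df.
  have : \forall y \near (0 : V), U (y + p).
    have := open_nbhs_nbhs (conj oU Up).
    by rewrite -[nbhs p U]/(\forall q \near p, U q) (near_shift 0) subr0.
  move=> oUp df; near=> y.
  have Uy : U (y + p) by near: y.
  rewrite -[leLHS]/(`|g (y + p) - (g p + 'd f p y)|) -(fg _ Uy) -(fg _ Up).
  near: y; exact: df.
apply/diff_locallyP; rewrite (diff_unique cdf dg); split => //.
Unshelve. all: by end_near. Qed.

Lemma smooth_upto_eq n U f g : open U -> (forall p, U p -> f p = g p) ->
  smooth_upto n U f -> smooth_upto n U g.
Proof.
elim: n f g => [|n IH] f g oU fg /=.
  move=> cf p Up; have cfp := cf p Up.
  rewrite /prop_for /continuous_at -(fg p Up) in cfp *.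
  apply: (cvg_trans _ cfp); apply: near_eq_cvg.
  by apply: filterS (open_nbhs_nbhs (conj oU Up)) => q Uq; exact: fg.
move=> [df sf]; split=> [p Up|v].
  exact: (differentiable_eq_on oU fg Up (df _ Up)).
by apply: IH (sf v) => // p Up; exact: (derive_eq_on v oU fg).
Qed.

Lemma smooth_uptoW n U f : smooth_upto n.+1 U f -> smooth_upto n U f.
Proof.
elim: n f => [|n IH] f [df sf].
  by move=> p Up; exact/differentiable_continuous/df.
by split => // v; exact: IH.
Qed.

Lemma smooth_upto_subset n U U' f :
  U' `<=` U -> smooth_upto n U f -> smooth_upto n U' f.
Proof.
move=> UU; elim: n f => [|n IH] f /=; first by move=> cf p /UU; exact: cf.
by move=> [df sf]; split=> [p /UU|v]; [exact: df|exact: IH].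
Qed.

Lemma smooth_upto_cst n U (c : W) : smooth_upto n U (fun=> c).
Proof.
elim: n c => [|n IH] c; first by move=> p _; exact: cst_continuous.
split=> [p _|v]; first exact: differentiable_cst.
rewrite (_ : 'D_v _ = fun=> 0)//.
by apply/funext => p; rewrite -[LHS]/('D_v (cst c) p) derive_cst.
Qed.

Lemma smooth_uptoD n U f g : open U -> smooth_upto n U f -> smooth_upto n U g ->
  smooth_upto n U (fun p => f p + g p).
Proof.
elim: n f g => [|n IH] f g oU.
  by move=> cf cg p Up; apply: cvgD; [exact: cf|exact: cg].
move=> [df sf] [dg sg]; split=> [p Up|v].
  by apply: differentiableD; [exact: df|exact: dg].
apply: smooth_upto_eq (IH _ _ oU (sf v) (sg v)) => // p Up.
by rewrite -deriveD//; apply: diff_derivable; [exact: df|exact: dg].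
Qed.

Lemma smooth_uptoN n U f : open U -> smooth_upto n U f ->
  smooth_upto n U (fun p => - f p).
Proof.
elim: n f => [|n IH] f oU.
  by move=> cf p Up; apply: cvgN; exact: cf.
move=> [df sf]; split=> [p Up|v].
  by apply: differentiableN; exact: df.
apply: smooth_upto_eq (IH _ oU (sf v)) => // p Up.
by rewrite -deriveN//; apply: diff_derivable; exact: df.
Qed.

Lemma smooth_differentiable U f p : smooth U f -> U p -> differentiable f p.
Proof. by move=> /(_ 1%N)[df _]; exact: df. Qed.

Lemma smooth_derivable U f p v : smooth U f -> U p -> derivable f p v.
Proof. by move=> sf Up; exact/diff_derivable/smooth_differentiable/Up. Qed.

Lemma smooth_continuous U f p : smooth U f -> U p -> {for p, continuous f}.
Proof. by move=> /(_ 0%N); exact. Qed.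

Lemma smooth_derive U f v : smooth U f -> smooth U ('D_v f).
Proof. by move=> sf n; have [_] := sf n.+1; exact. Qed.

Lemma smooth_eq U f g : open U -> (forall p, U p -> f p = g p) ->
  smooth U f -> smooth U g.
Proof. by move=> oU fg sf n; exact: smooth_upto_eq (sf n). Qed.

Lemma smooth_subset U U' f : U' `<=` U -> smooth U f -> smooth U' f.
Proof. by move=> UU sf n; exact: smooth_upto_subset (sf n). Qed.

Lemma smooth_cst U (c : W) : smooth U (fun=> c).
Proof. by move=> n; exact: smooth_upto_cst. Qed.

Lemma smoothD U f g : open U -> smooth U f -> smooth U g ->
  smooth U (fun p => f p + g p).
Proof. by move=> oU sf sg n; exact: smooth_uptoD. Qed.

Lemma smoothN U f : open U -> smooth U f -> smooth U (fun p => - f p).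
Proof. by move=> oU sf n; exact: smooth_uptoN. Qed.

Lemma smoothB U f g : open U -> smooth U f -> smooth U g ->
  smooth U (fun p => f p - g p).
Proof. by move=> oU sf sg; apply: smoothD => //; exact: smoothN. Qed.

End SmoothMaps.

Section SmoothScalars.
Variables (K : numFieldType) (V : normedModType K).
Implicit Types (n : nat) (U : set V) (f g : V -> K).

Lemma smooth_uptoM n U f g : open U -> smooth_upto n U f -> smooth_upto n U g ->
  smooth_upto n U (fun p => f p * g p).
Proof.
elim: n f g => [|n IH] f g oU.
  by move=> cf cg p Up; apply: cvgM; [exact: cf|exact: cg].
move=> sf0 sg0; have [df sf] := sf0; have [dg sg] := sg0.
split=> [p Up|v].
  by apply: differentiableM; [exact: df|exact: dg].
apply: smooth_upto_eq (smooth_uptoD oU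
  (IH _ _ oU (smooth_uptoW sf0) (sg v)) (IH _ _ oU (smooth_uptoW sg0) (sf v)))
  => // p Up.
by rewrite deriveM//; apply: diff_derivable; [exact: df|exact: dg].
Qed.

Lemma smooth_uptoV n U f : open U -> (forall p, U p -> f p != 0) ->
  smooth_upto n U f -> smooth_upto n U (fun p => (f p)^-1).
Proof.
move=> oU f0; elim: n => [|n IH].
  by move=> cf p Up; apply: cvgV; [exact: f0|exact: cf].
move=> sf0; have [df sf] := sf0.
split=> [p Up|v].
  by apply: differentiableV; [exact: df|exact: f0].
have sV := IH (smooth_uptoW sf0).
apply: smooth_upto_eq (smooth_uptoN oU (smooth_uptoM oU
  (smooth_uptoM oU sV sV) (sf v))) => // p Up.
rewrite deriveV//; [|exact: f0|apply: diff_derivable; exact: df].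
by rewrite /= scaleNr expr2 invfM.
Qed.

Lemma smoothM U f g : open U -> smooth U f -> smooth U g ->
  smooth U (fun p => f p * g p).
Proof. by move=> oU sf sg n; exact: smooth_uptoM. Qed.

Lemma smoothV U f : open U -> (forall p, U p -> f p != 0) ->
  smooth U f -> smooth U (fun p => (f p)^-1).
Proof. by move=> oU f0 sf n; exact: smooth_uptoV. Qed.

End SmoothScalars.

Section SmoothPlane.
Variables (K : numFieldType) (V : normedModType K).
Implicit Types (n : nat) (U : set V).

Lemma derive_pair (f g : V -> K) p v :
  differentiable f p -> differentiable g p ->
  'D_v (fun q => (f q, g q) : plane K) p = ('D_v f p, 'D_v g p).
Proof.
move=> df dg; rewrite deriveE; last exact: differentiable_pair.
by rewrite diff_pair// -!deriveE.
Qed.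

Lemma differentiable_fst (p : plane K) : differentiable (@fst K K) p.
Proof. by apply: linear_differentiable => q; exact: cvg_fst. Qed.

Lemma differentiable_snd (p : plane K) : differentiable (@snd K K) p.
Proof. by apply: linear_differentiable => q; exact: cvg_snd. Qed.

Lemma derive_fst (f : V -> plane K) p v :
  differentiable f p -> 'D_v (fun q => (f q).1) p = ('D_v f p).1.
Proof.
move=> df; have d1 := differentiable_fst (f p).
rewrite deriveE; last exact: (differentiable_comp df d1).
rewrite (diff_comp df d1) /= (@diff_lin _ _ _ (@fst K K)) -?deriveE//.
by move=> q; exact: cvg_fst.
Qed.

Lemma derive_snd (f : V -> plane K) p v :
  differentiable f p -> 'D_v (fun q => (f q).2) p = ('D_v f p).2.
Proof.
move=> df; have d1 := differentiable_snd (f p).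
rewrite deriveE; last exact: (differentiable_comp df d1).
rewrite (diff_comp df d1) /= (@diff_lin _ _ _ (@snd K K)) -?deriveE//.
by move=> q; exact: cvg_snd.
Qed.

Lemma smooth_upto_pair n U (f g : V -> K) : open U ->
  smooth_upto n U f -> smooth_upto n U g ->
  smooth_upto n U (fun p => (f p, g p) : plane K).
Proof.
move=> oU; elim: n f g => [|n IH] f g.
  move=> cf cg p Up.
  exact: (@cvg_pair _ _ _ _ (nbhs (f p)) (nbhs (g p)) _ _ _ f g
    (cf p Up) (cg p Up)).
move=> [df sf] [dg sg]; split=> [p Up|v].
  by apply: differentiable_pair; [exact: df|exact: dg].
apply: smooth_upto_eq (IH _ _ (sf v) (sg v)) => // p Up.
by rewrite derive_pair//; [exact: df|exact: dg].
Qed.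

Lemma smooth_upto_fst n U (f : V -> plane K) : open U ->
  smooth_upto n U f -> smooth_upto n U (fun p => (f p).1).
Proof.
move=> oU; elim: n f => [|n IH] f.
  by move=> cf p Up; apply: (cvg_comp _ _ (cf p Up)); exact: cvg_fst.
move=> [df sf]; split=> [p Up|v].
  by apply: (differentiable_comp (df p Up)); exact: differentiable_fst.
apply: smooth_upto_eq (IH _ (sf v)) => // p Up.
by rewrite derive_fst//; exact: df.
Qed.

Lemma smooth_upto_snd n U (f : V -> plane K) : open U ->
  smooth_upto n U f -> smooth_upto n U (fun p => (f p).2).
Proof.
move=> oU; elim: n f => [|n IH] f.
  by move=> cf p Up; apply: (cvg_comp _ _ (cf p Up)); exact: cvg_snd.
move=> [df sf]; split=> [p Up|v].
  by apply: (differentiable_comp (df p Up)); exact: differentiable_snd.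
apply: smooth_upto_eq (IH _ (sf v)) => // p Up.
by rewrite derive_snd//; exact: df.
Qed.

Lemma smooth_pair U (f g : V -> K) : open U -> smooth U f -> smooth U g ->
  smooth U (fun p => (f p, g p) : plane K).
Proof. by move=> oU sf sg n; exact: smooth_upto_pair. Qed.

Lemma smooth_fst U (f : V -> plane K) : open U ->
  smooth U f -> smooth U (fun p => (f p).1).
Proof. by move=> oU sf n; exact: smooth_upto_fst. Qed.

Lemma smooth_snd U (f : V -> plane K) : open U ->
  smooth U f -> smooth U (fun p => (f p).2).
Proof. by move=> oU sf n; exact: smooth_upto_snd. Qed.

Lemma diff_plane (W : normedModType K) (g : plane K -> W) p v :
  differentiable g p ->
  'D_v g p = v.1 *: 'D_(1, 0) g p + v.2 *: 'D_(0, 1) g p.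
Proof.
move=> dg; rewrite !deriveE// -!linearZ -linearD; congr ('d g p _).
case: v => a b; rewrite /=; congr pair => /=.
  by rewrite -[RHS]/(a * 1 + b * 0) mulr1 mulr0 addr0.
by rewrite -[RHS]/(a * 0 + b * 1) mulr1 mulr0 add0r.
Qed.

Lemma derive_comp (W W' : normedModType K) (f : V -> W') (g : W' -> W) p v :
  differentiable f p -> differentiable g (f p) ->
  'D_v (fun q => g (f q)) p = 'D_('D_v f p) g (f p).
Proof.
move=> df dg; rewrite !deriveE//; last exact: (differentiable_comp df dg).
by rewrite (diff_comp df dg).
Qed.

Lemma smooth_upto_comp n U (U' : set (plane K)) (f : V -> plane K)
    (g : plane K -> K) :
  open U -> (forall p, U p -> U' (f p)) ->
  smooth_upto n U f -> smooth_upto n U' g ->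
  smooth_upto n U (fun p => g (f p)).
Proof.
move=> oU UU'; elim: n g => [|n IH] g.
  move=> cf cg p Up; apply: (cvg_comp _ _ (cf p Up)); exact/cg/UU'.
move=> sf0 [dg sg]; have [df sf] := sf0; have sfn := smooth_uptoW sf0.
split=> [p Up|v].
  by apply: (differentiable_comp (df p Up)); exact/dg/UU'.
(* The direction ['D_v f p] varies with [p]. Splitting it along the two axes leaves derivatives of
   [g] in fixed directions, to which the induction hypothesis applies. *)
apply: smooth_upto_eq (smooth_uptoD oU
  (smooth_uptoM oU (smooth_upto_fst oU (sf v)) (IH _ sfn (sg (1, 0))))
  (smooth_uptoM oU (smooth_upto_snd oU (sf v)) (IH _ sfn (sg (0, 1))))) => //.
move=> p Up; have dgf := dg _ (UU' _ Up).
by rewrite (derive_comp _ (df p Up) dgf) [RHS](diff_plane _ dgf).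
Qed.

Lemma smooth_comp U (U' : set (plane K)) (f : V -> plane K)
    (g : plane K -> K) : open U -> (forall p, U p -> U' (f p)) ->
  smooth U f -> smooth U' g -> smooth U (fun p => g (f p)).
Proof. by move=> oU UU' sf sg n; exact: smooth_upto_comp (sg n). Qed.

End SmoothPlane.

Lemma smooth_comp_plane (K : numFieldType) (V : normedModType K)
    (U : set V) (U' : set (plane K)) (f : V -> plane K)
    (g : plane K -> plane K) : open U -> open U' ->
  (forall p, U p -> U' (f p)) ->
  smooth U f -> smooth U' g -> smooth U (fun p => g (f p)).
Proof.
move=> oU oU' UU' sf sg.
have := smooth_pair oU (smooth_comp oU UU' sf (smooth_fst oU' sg))
  (smooth_comp oU UU' sf (smooth_snd oU' sg)).
by apply: smooth_eq => // p Up; rewrite -surjective_pairing.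
Qed.

Lemma smooth_id (K : numFieldType) (W : normedModType K) (U : set W) : smooth U id.
Proof.
case=> [|n]; first by move=> p _; exact: cvg_id.
split=> [p _|v]; first by apply: ex_diff; exact: is_diff_id.
rewrite (_ : 'D_v id = fun=> v); first exact: smooth_upto_cst.
by apply/funext => p; rewrite derive_id.
Qed.

(** * Mean values and mixed derivatives *)

(* What the real and the complex field have in common: real segments along which
   real-valued components of K-differentiable functions can be differentiated.
   For K = R both parts are the identity. *)
Record real_parts (R : realType) (K : numFieldType) := RealParts {
  emb :> {rmorphism R -> K};
  part : bool -> K -> R;
  emb_continuous : continuous emb;
  emb_le1 : forall s, 0 <= s <= 1 -> `|emb s| <= 1;
  part_continuous : forall b, continuous (part b);
  partB : forall b, {morph part b : x y / x - y};
  partZ : forall b s z, part b (emb s * z) = s * part b z;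
  part_eq0 : forall z, (forall b, part b z = 0) -> z = 0 }.

Section MeanValue.
Variables (R : realType) (K : numFieldType) (e : real_parts R K).
Variable V : normedModType K.
Implicit Types (f : V -> K) (p v w : V) (b : bool) (s t : R).

Lemma derive_shift_arg f p v w :
  'D_v (fun q => f (q + w)) p = 'D_v f (p + w).
Proof. by rewrite /derive; under eq_fun do rewrite /= -addrA. Qed.

Lemma derivable_shift_arg f p v w :
  derivable f (p + w) v -> derivable (fun q => f (q + w)) p v.
Proof.
by rewrite /derivable; under [in X in _ -> X]eq_fun do rewrite /= -addrA.
Qed.

Lemma emb_dnbhs : e x @[x --> 0^'] --> 0^'.
Proof.
move=> A A0; have : e x @[x --> (0 : R)] --> (0 : K).
  by rewrite -[0 in X in _ --> X](rmorph0 e); exact: emb_continuous.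
have {}A0 : nbhs (0 : K) [set k | k != 0 -> A k] := A0.
move=> /(_ _ A0) H.
have H' : nbhs (0 : R) [set h | e h != 0 -> A (e h)] := H.
have : nbhs (0 : R) [set h | h != 0 -> A (e h)]; last by [].
by apply: filterS H' => h Ah h0; apply: Ah; rewrite fmorph_eq0.
Qed.

Lemma emb_near0 (k : K) : 0 < k -> \forall t \near (0 : R), `|e t| < k.
Proof.
have : e x @[x --> (0 : R)] --> (0 : K).
  by rewrite -[0 in X in _ --> X](rmorph0 e); exact: emb_continuous.
by move=> /cvgr0_norm_lt; apply.
Qed.

(** The [K]-difference quotient converges in particular along the real increments [e h], and [partB]
    and [partZ] carry [part] through it. *)
Lemma is_derive_segment b f p v s : derivable f (p + e s *: v) v ->
  is_derive s 1 (fun t => part e b (f (p + e t *: v)))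
    (part e b ('D_v f (p + e s *: v))).
Proof.
set q := p + _ => df.
have cv : (h^-1 *: (part e b (f (p + e (h *: 1 + s) *: v)) - part e b (f q)))
    @[h --> 0^'] --> part e b ('D_v f q).
  have -> : (fun h => h^-1 *: (part e b (f (p + e (h *: 1 + s) *: v))
      - part e b (f q)))
      = part e b \o (fun k => k^-1 *: (f (k *: v + q) - f q)) \o e.
    apply/funext => h /=; rewrite -partB -[LHS]partZ fmorphV.
    congr (part e b (_ * (f _ - _))).
    by rewrite [h *: 1]mulr1 rmorphD scalerDl addrCA.
  apply: (cvg_comp _ _ emb_dnbhs).
  by apply: (cvg_comp _ _ df); exact: part_continuous.
split; first by apply/cvg_ex; exists (part e b ('D_v f q)).
exact: cvg_lim cv.
Qed.

(** The intermediate point depends on [b]: over the complex field a mean value exists for each real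
    component, but in general not for [f] itself. *)
Lemma segment_MVT b f p v s : 0 < s ->
  (forall t, 0 <= t <= s -> derivable f (p + e t *: v) v) ->
  exists2 t, 0 <= t <= s &
    part e b (f (p + e s *: v)) - part e b (f p)
      = s * part e b ('D_v f (p + e t *: v)).
Proof.
move=> s0 df.
have [||t] := @MVT R (fun t => part e b (f (p + e t *: v)))
  (fun t => part e b ('D_v f (p + e t *: v))) 0 s s0.
- move=> t; rewrite in_itv /= => /andP[t0 ts].
  by apply: is_derive_segment; apply: df; rewrite !ltW.
- apply: derivable_within_continuous => t; rewrite in_itv /= => ts.
  by have [] := is_derive_segment b (df t ts).
rewrite in_itv /= => /andP[t0 ts].
rewrite rmorph0 scale0r addr0 subr0 mulrC => Et.
by exists t => //; rewrite !ltW.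
Qed.


Lemma segment_derive0 f p v :
  (forall t, 0 <= t <= 1 ->
     derivable f (p + e t *: v) v /\ 'D_v f (p + e t *: v) = 0) ->
  f (p + v) = f p.
Proof.
move=> df; apply/eqP; rewrite -subr_eq0; apply/eqP.
apply: (@part_eq0 _ _ e) => b; rewrite partB.
have [|t t01] := @segment_MVT b f p v 1 ltr01.
  by move=> t /df[].
rewrite rmorph1 scale1r mul1r => ->.
by have [_ ->] := df _ t01; rewrite -[0]subr0 partB subrr.
Qed.

(** The second difference over the parallelogram is the increment along [v] of f(q + s w) - f(q).
    One mean value along [v], then one along [w], turn it into a second derivative. *)
Lemma parallelogram_MVT b f p v w s : 0 < s ->
  (forall a t, 0 <= a <= s -> 0 <= t <= s ->
    let q := p + e a *: v + e t *: w in
    derivable f q v /\ derivable ('D_v f) q w) ->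
  exists a t, [/\ 0 <= a <= s, 0 <= t <= s &
    part e b (f (p + e s *: v + e s *: w)) - part e b (f (p + e s *: v))
    - (part e b (f (p + e s *: w)) - part e b (f p))
    = s * (s * part e b ('D_w ('D_v f) (p + e a *: v + e t *: w)))].
Proof.
move=> s0 df; have ss : 0 <= s <= s by rewrite lexx ltW.
have z0 : (0 : R) <= 0 <= s by rewrite lexx ltW.
have dfa a : 0 <= a <= s ->
    derivable (fun q => f (q + e s *: w)) (p + e a *: v) v /\
    derivable f (p + e a *: v) v.
  move=> sa; split; first by apply: derivable_shift_arg; have [] := df a s sa ss.
  by have [] := df a 0 sa z0; rewrite /= rmorph0 scale0r addr0.
have [|a sa] := @segment_MVT b (fun q => f (q + e s *: w) - f q) p v s s0.
  by move=> t /dfa[d1 d2]; apply: derivableB.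
have [d1 d2] := dfa a sa.
rewrite deriveB// derive_shift_arg !partB => Ea.
have [|t ts Et] := @segment_MVT b ('D_v f) (p + e a *: v) w s s0.
  by move=> t ts; have [] := df a t sa ts.
by exists a, t; rewrite Ea Et.
Qed.

End MeanValue.

(** * Symmetry of second derivatives *)

Section Schwarz.
Variables (R : realType) (K : numFieldType) (e : real_parts R K).
Variable V : normedModType K.
Implicit Types (f : V -> K) (p v w : V) (U : set V).

(** The second difference over a parallelogram is symmetric in [v] and [w]. Evaluated in both
    orders, it shows that a component of [H] at one point equals that of [G] at another, and both
    points are as close to [p] as desired; by continuity the components cannot differ at [p]. *)
Lemma derive_symmetric U f p v w : open U -> U p -> smooth U f ->
  'D_v ('D_w f) p = 'D_w ('D_v f) p.
Proof.
move=> oU Up sf; apply/eqP; rewrite -subr_eq0; apply/eqP.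
apply: (@part_eq0 _ _ e) => b; rewrite partB; apply/eqP; rewrite subr_eq0.
set G := 'D_v ('D_w f); set H := 'D_w ('D_v f).
apply/negPn/negP => GH; pose d := `|part e b (G p) - part e b (H p)| / 2.
have d0 : 0 < d by rewrite divr_gt0// normr_gt0 subr_eq0.
have near_part F : smooth U F ->
    \forall q \near p, `|part e b (F p) - part e b (F q)| < d.
  move=> sF; have cF : F q @[q --> p] --> F p := smooth_continuous sF Up.
  have : part e b (F q) @[q --> p] --> part e b (F p).
    exact: (cvg_comp _ _ cF (@part_continuous _ _ e b _)).
  by move/cvgr_dist_lt; apply.
have sG : smooth U G by do 2 apply: smooth_derive.
have sH : smooth U H by do 2 apply: smooth_derive.
pose m (z : R * R) := p + e z.1 *: v + e z.2 *: w.
pose N := [set q | [/\ U q, `|part e b (G p) - part e b (G q)| < d &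
    `|part e b (H p) - part e b (H q)| < d]].
have pN : nbhs p N.
  have FI := @filterI _ _ (nbhs_filter p).
  have oN := FI _ _ (open_nbhs_nbhs (conj oU Up))
    (FI _ _ (near_part _ sG) (near_part _ sH)).
  by apply: filterS oN => q [Uq [Gq Hq]]; split.
have [r /= r0 pr] := (nbhs_ballP _ _).1 pN.
(* Coefficients of absolute value below [k] move [p] by less than [r]; the 1 keeps the denominator
   positive when [v] and [w] are both 0. *)
pose k := r / (`|v| + `|w| + 1).
have vw0 : 0 < `|v| + `|w| + 1 by rewrite ltr_wpDl// addr_ge0.
have k0 : 0 < k by rewrite divr_gt0.
have [d' /= d'0 ed] := (nbhs_ballP _ _).1 (emb_near0 e k0).
(* The side is halved because the coefficients range over a closed interval, while [ed] needs a
   strict bound by [d']. *)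
have s0 : 0 < d' / 2 by rewrite divr_gt0.
have ek a : 0 <= a <= d' / 2 -> `|e a| < k.
  move=> /andP[a0 ad]; apply: ed; rewrite /ball /= sub0r normrN ger0_norm//.
  by apply: le_lt_trans ad _; rewrite ltr_pdivrMr// ltr_pMr// ltr1n.
have inN a t : 0 <= a <= d' / 2 -> 0 <= t <= d' / 2 -> N (m (a, t)).
  move=> /ek ak /ek tk; apply: pr.
  rewrite -ball_normE /= /m /= opprD addrA opprD addrA subrr sub0r.
  apply: (le_lt_trans (ler_normB _ _)); rewrite normrN !normrZ.
  apply: (@le_lt_trans _ _ (k * (`|v| + `|w|))).
    by rewrite mulrDr lerD// ler_wpM2r// ltW.
  by rewrite /k mulrAC ltr_pdivrMr// ltr_pM2l// ltrDl.
have [|a [t [ar tr E1]]] := @parallelogram_MVT _ _ e V b f p v w (d' / 2) s0.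
  move=> a t ar tr /=; have [Uq _ _] := inN a t ar tr.
  by split; apply: smooth_derivable Uq => //; exact: smooth_derive.
have [|a' [t' [ar' tr' E2]]] := @parallelogram_MVT _ _ e V b f p w v (d' / 2) s0.
  move=> c u cr ur /=; have [Uq _ _] := inN u c ur cr.
  rewrite addrAC.
  by split; apply: smooth_derivable Uq => //; exact: smooth_derive.
have [_ _ Hq] := inN a t ar tr.
have [_ Gq _] := inN t' a' tr' ar'.
suff E : part e b (H (m (a, t))) = part e b (G (m (t', a'))).
  have far (x y u : R) :
      `|x - u| < `|x - y| / 2 -> `|y - u| < `|x - y| / 2 -> False.
    move=> xu yu; have := ler_distD u x y; rewrite (distrC u y).
    by rewrite leNgt => /negP; apply; rewrite [ltRHS]splitr ltrD.
  exact: (far _ _ _ Gq (eq_ind _ (fun u => `|part e b (H p) - u| < d) Hq _ E)).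
have r2 : d' / 2 != 0 by rewrite gt_eqF.
apply: (mulfI r2); apply: (mulfI r2).
have m' : m (t', a') = p + e a' *: w + e t' *: v by exact: addrAC.
apply: (etrans (esym E1)); apply: (etrans _ (congr1 (fun q =>
  d' / 2 * (d' / 2 * part e b (G q))) (esym m'))).
apply: (etrans _ E2); rewrite (addrAC p (e (d' / 2) *: v)).
by rewrite !opprB !addrA; ring.
Qed.

End Schwarz.

Section BallConstant.
Variables (R : realType) (K : numFieldType) (e : real_parts R K).

(** By [emb_le1] the real segment from the centre to [q] stays in the ball, and the derivative along
    it is a combination of the two partial ones. *)
Lemma ball_derive0 (f : plane K -> K) (p q : plane K) (r : K) :
  (forall z, ball p r z -> [/\ differentiable f z, 'D_(1, 0) f z = 0 &
    'D_(0, 1) f z = 0]) -> ball p r q -> f q = f p.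
Proof.
move=> df pq; suff : f (p + (q - p)) = f p by rewrite addrC subrK.
apply: (@segment_derive0 _ _ e) => t t01.
have [|dz d1 d2] := df (p + e t *: (q - p)).
  rewrite -ball_normE /= opprD addrA subrr sub0r normrN normrZ.
  move: pq; rewrite -ball_normE /= distrC => pq; apply: le_lt_trans pq.
  by rewrite ler_piMl// emb_le1.
split; first exact: diff_derivable.
by rewrite diff_plane// d1 d2 !scaler0 addr0.
Qed.

End BallConstant.

(** * Real components of the two ground fields *)

Section ComplexParts.
Variable R : realType.
Local Open Scope complex_scope.

Definition complex_part (b : bool) (z : R[i]) : R :=
  if b then complex.Im z else complex.Re z.

Lemma complex_part_le b z : `|complex_part b z|%:C <= `|z|.
Proof.
case: b => /=; last exact: normc_ge_Re.
rewrite normc_def -sqrtr_sqr lecR; apply: ler_wsqrtr.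
by rewrite lerDr sqr_ge0.
Qed.

Lemma complex_partB b : {morph complex_part b : x y / x - y}.
Proof. by case: b => - [x1 x2] [y1 y2]. Qed.

Lemma complex_part_continuous b :
  continuous (complex_part b : (complex R : numFieldType) -> R).
Proof.
move=> z; apply/(@cvgrPdist_lt _ _ _ (nbhs z)) => d d0.
have zd : nbhs z (ball z d%:C) by apply: nbhsx_ballx; rewrite ltcR.
apply: (@filterS _ _ (nbhs_filter z) _ _ _ zd) => y; rewrite -ball_normE /= => yd.
by rewrite -complex_partB -ltcR; exact: le_lt_trans (complex_part_le _ _) yd.
Qed.

Lemma real_complex_continuous :
  continuous (real_complex R : R -> (complex R : numFieldType)).
Proof.
move=> s; apply/(@cvgrPdist_lt _ _ _ (nbhs s)) => d d0.
(* In the order of the complex numbers a positive element has zero imaginary part, so [d] has a real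
   radius below it. *)
have [r r0 rd] : exists2 r : R, 0 < r & r%:C <= d.
  case: d d0 => a b; rewrite ltcE => /andP[/eqP /= b0 a0].
  by exists a => //; rewrite lecE /= b0 eqxx lexx.
have sr : nbhs s (ball s r) by exact: nbhsx_ballx.
apply: (@filterS _ _ (nbhs_filter s) _ _ _ sr) => t; rewrite -ball_normE /= => tr.
rewrite -rmorphB normc_def /= expr0n addr0 sqrtr_sqr.
by apply: lt_le_trans rd; rewrite ltcR.
Qed.

Definition complex_real_parts : real_parts R (complex R).
Proof.
exists (real_complex R) complex_part.
- exact: real_complex_continuous.
- move=> s /andP[s0 s1]; rewrite normc_def /= expr0n addr0 sqrtr_sqr lecR.
  by rewrite ger0_norm.
- exact: complex_part_continuous.
- exact: complex_partB.
- by move=> [] s [x y] /=; rewrite mul0r ?addr0 ?subr0.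
- by move=> [x y] h; have := h true; have := h false; rewrite /= => -> ->.
Defined.

End ComplexParts.

Definition real_real_parts (R : realType) : real_parts R R.
Proof.
exists idfun (fun=> id).
- by move=> x; exact: cvg_id.
- by move=> s /andP[s0 s1]; rewrite ger0_norm.
- by move=> b x; exact: cvg_id.
- by [].
- by [].
- by move=> z /(_ true).
Defined.

(** * Transport of webs *)

Section WebTransport.
Variable K : numFieldType.
Implicit Types (D U V L : set (plane K)) (F : set (set (plane K))).
Implicit Types (f g h phi : plane K -> plane K).

(** A form symmetric in [h] and its inverse: [diffeo] only provides a left inverse, which
    surjectivity makes two-sided. *)
Lemma diffeoP U V h : diffeo U V h <-> smooth U h /\ exists g,
  [/\ smooth V g, forall p, U p -> V (h p) /\ g (h p) = p &
      forall q, V q -> U (g q) /\ h (g q) = q].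
Proof.
split=> [[[hV hI hS] sh [g sg gK]]|[sh [g [sg hK gK]]]].
  split=> //; exists g; split => // [p Up|q /hS[p Up <-]]; last by rewrite gK.
  by split; [exact: hV|exact: gK].
split=> //; last by exists g => // p /hK[].
split=> [p /hK[]//|p q|q /gK[Ug hg]].
  by rewrite !inE => /hK[_ {2}<-] /hK[_ {2}<-] ->.
by exists (g q).
Qed.

Lemma diffeo_id U : diffeo U U id.
Proof. by apply/diffeoP; split; [|exists id; split=> //]; exact: smooth_id. Qed.

Lemma diffeo_comp U V V' h f : open U -> open V -> open V' ->
  diffeo U V h -> diffeo V V' f -> diffeo U V' (f \o h).
Proof.
move=> oU oV oV' /diffeoP[sh [g [sg hK gK]]] /diffeoP[sf [g' [sg' fK gK']]].
apply/diffeoP; split.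
  by apply: (smooth_comp_plane oU oV) sh sf => p /hK[].
exists (g \o g'); split.
- by apply: (smooth_comp_plane oV' oV) sg' sg => q /gK'[].
- by move=> p /hK[Vh gh] /=; have [V'f gf] := fK _ Vh; rewrite gf gh.
- by move=> q /gK'[Vg fg] /=; have [Ug hg] := gK _ Vg; rewrite hg fg.
Qed.

Lemma diffeo_subset U V U' h : U' `<=` U -> diffeo U V h -> diffeo U' (h @` U') h.
Proof.
move=> UU /diffeoP[sh [g [sg hK gK]]].
have hV : h @` U' `<=` V by move=> _ [p /UU/hK[Vh _] <-].
apply/diffeoP; split; first exact: smooth_subset sh.
exists g; split; first exact: smooth_subset sg.
- by move=> p Up; split; [exists p|have [] := hK _ (UU _ Up)].
- by move=> _ [p Up <-]; have [_ ->] := hK _ (UU _ Up).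
Qed.

Lemma diffeo_inv U V h : diffeo U V h -> exists2 g, diffeo V U g &
  (forall p, U p -> g (h p) = p) /\ (forall q, V q -> h (g q) = q).
Proof.
move=> /diffeoP[sh [g [sg hK gK]]]; exists g.
  by apply/diffeoP; split=> //; exists h.
by split=> [p /hK[]|q /gK[]].
Qed.

Lemma diffeo_inj U V h p q : diffeo U V h -> U p -> U q -> h p = h q -> p = q.
Proof.
by move=> /diffeo_inv[g _ [hK _]] Up Uq pq; rewrite -(hK p Up) pq hK.
Qed.

Lemma diffeo_image U V h : diffeo U V h -> h @` U = V.
Proof.
move=> /diffeoP[_ [g [_ hK gK]]]; apply/seteqP; split=> [_ [p /hK[Vh _] <-]//|q].
by move=> /gK[Ug hg]; exists (g q).
Qed.

Lemma diffeo_open U V U' h : U' `<=` U -> open U' -> open V ->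
  diffeo U V h -> open (h @` U').
Proof.
move=> UU oU' oV /diffeoP[sh [g [sg hK gK]]]; rewrite openE => _ [p U'p <-].
have [Vh ghp] := hK _ (UU _ U'p).
have cg : g q @[q --> h p] --> g (h p) := smooth_continuous sg Vh.
have U'n : nbhs (g (h p)) U' by rewrite ghp; exact: open_nbhs_nbhs.
have N := @filterI _ _ (nbhs_filter (h p)) _ _
  (open_nbhs_nbhs (conj oV Vh)) (cg _ U'n).
apply: (@filterS _ _ (nbhs_filter (h p)) _ _ _ N) => q [Vq U'g].
by exists (g q) => //; have [] := gK _ Vq.
Qed.

Lemma smooth_within_continuous U U' f : U' `<=` U -> smooth U f ->
  {within U', continuous f}.
Proof.
move=> UU sf; apply: continuous_in_subspaceT => p /set_mem /UU Up.
exact: smooth_continuous sf Up.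
Qed.

Lemma smooth_connected U L f : L `<=` U -> smooth U f -> connected L ->
  connected (f @` L).
Proof.
by move=> LU sf cL; apply: connected_continuous_connected cL _;
  exact: smooth_within_continuous LU sf.
Qed.

Lemma smooth_component U L f p : L `<=` U -> smooth U f -> L p ->
  f @` connected_component L p `<=` connected_component (f @` L) (f p).
Proof.
move=> LU sf Lp _ [q [C [Cp CL cC] Cq] <-]; exists (f @` C) => //; split.
- by exists p.
- exact: image_subset.
- by apply: smooth_connected sf cC; exact: subset_trans LU.
Qed.

(** [flow_box] speaks of components of leaves, so charts can be transported only if components are.
    The two inclusions are the continuity of [h] and of its inverse. *)
Lemma diffeo_component U V L h p : diffeo U V h -> L `<=` U -> L p ->
  connected_component (h @` L) (h p) = h @` connected_component L p.
Proof.
move=> dh LU Lp; have [g /diffeoP[sg _] [hK gK]] := diffeo_inv dh.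
have [sh _] := (diffeoP _ _ _).1 dh.
have hLV : h @` L `<=` V by rewrite -(diffeo_image dh); exact: image_subset.
have ghL : g @` (h @` L) = L.
  rewrite image_comp; apply/seteqP; split=> [_ [q Lq <-]|q Lq] /=.
    by rewrite hK//; exact: LU.
  by exists q => //=; rewrite hK//; exact: LU.
apply/seteqP; split; last exact: smooth_component sh Lp.
move=> q Cq; have Vq : V q by apply: hLV; exact: connected_component_sub Cq.
exists (g q); last exact: gK.
have := smooth_component hLV sg (imageP h Lp).
by rewrite ghL hK; [apply; exists q|exact: LU].
Qed.

Lemma tangent_image D L f p v : open D -> smooth D f -> L `<=` D ->
  tangent L p v -> tangent (f @` L) (f p) ('D_v f p).
Proof.
move=> oD sf LD [I [g [[oI I0 sg] [gL g0 dg]]]].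
have gD t : I t -> D (g t) by move=> It; apply: LD; apply: gL; exists t.
exists I, (fun t => f (g t)); split; split; [exact: oI|exact: I0| | | |].
- exact: (smooth_comp_plane oI oD gD sg sf).
- by move=> _ [t It <-]; exists (g t) => //; apply: gL; exists t.
- by rewrite g0.
rewrite derive1E (derive_comp _ (smooth_differentiable sg I0)
  (smooth_differentiable sf (gD _ I0))).
by rewrite -derive1E dg g0.
Qed.

Lemma foliation_subset D F L : foliation D F -> F L -> L `<=` D.
Proof. by move=> [[<- _ _] _ _] FL p Lp; exists L. Qed.

(** A chart of the image is an old chart composed with the inverse of [phi], over the image of the
    old flow box. *)
Lemma diffeo_foliation D D' phi F : open D -> open D' -> diffeo D D' phi ->
  foliation D F -> foliation D' ((fun L => phi @` L) @` F).
Proof.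
move=> oD oD' dphi fF; have LD := foliation_subset fF.
have [g dg [phiK gK]] := diffeo_inv dphi.
have [sphi _] := (diffeoP _ _ _).1 dphi.
have [[cF tF nF] conF boxF] := fF; split.
- split.
  + rewrite -(diffeo_image dphi); apply/seteqP.
    split=> [q [_ [L FL <-] [p Lp <-]]|].
      by exists p => //; exact: LD FL _ Lp.
    move=> _ [p + <-]; rewrite -{1}cF => -[L FL Lp].
    by exists (phi @` L); [exists L|exists p].
  + move=> _ _ [L FL <-] [M FM <-] [q [[p Lp <-] [p' Mp' pp']]].
    have {}pp' : p' = p.
      by apply: (diffeo_inj dphi) pp'; [exact: LD FM _ _|exact: LD FL _ _].
    by rewrite (tF L M FL FM)//; exists p; split => //; rewrite -pp'.
  + by move=> _ [L FL <-]; have [p Lp] := nF _ FL; exists (phi p); exists p.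
- by move=> _ [L FL <-]; apply: smooth_connected sphi (conF _ FL); exact: LD.
- move=> q D'q; have /boxF[U [V [h [[oU oV Up UD] [dh bh]]]]] : D (g q).
    by rewrite -(diffeo_image dg); exists q.
  have oU' := diffeo_open UD oU oD' dphi.
  have [g' dg' [phiK' gK']] := diffeo_inv (diffeo_subset UD dphi).
  exists (phi @` U), V, (h \o g'); split.
    split=> //; first by exists (g q) => //; exact: gK.
    by rewrite -(diffeo_image dphi); exact: image_subset.
  split; first exact: diffeo_comp dg' dh.
  move=> _ _ [L FL <-] [p Lp <-] [p' Up' pp'].
  have {}pp' : p' = p.
    by apply: (diffeo_inj dphi) pp'; [exact: UD|exact: LD FL _ _].
  rewrite pp' in Up'.
  have -> : (phi @` L) `&` (phi @` U) = phi @` (L `&` U).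
    apply/seteqP; split=> [_ [[r Lr <-] [r' Ur' rr']]|_ [r [Lr Ur] <-]]; last first.
      by split; exists r.
    exists r => //; split=> //; suff -> : r = r' by [].
    by apply: (diffeo_inj dphi) (esym rr'); [exact: LD FL _ _|exact: UD].
  rewrite (diffeo_component dphi)//; last by move=> r [/(LD _ FL)].
  rewrite bh//; apply/seteqP; split=> [_ [r [Ur hr] <-]|_ [[r Ur <-] /= hr]].
    by split; [exists r|rewrite /= !phiK'].
  by exists r => //; split => //; move: hr; rewrite !phiK'.
Qed.

(** The differential of [phi] is undone by that of its inverse, so each tangent set is recovered
    from its image; equal tangents of two image leaves would come from equal tangents of the
    original ones. *)
Lemma diffeo_web4 D D' phi (X : 'I_4 -> set (set (plane K))) : open D' ->
  diffeo D D' phi -> web4 D X -> web4 D' (fun c => (fun L => phi @` L) @` X c).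
Proof.
move=> oD' dphi [oD cD fX tX sX].
have LD c := foliation_subset (fX c).
have [g dg [phiK gK]] := diffeo_inv dphi.
have [sphi _] := (diffeoP _ _ _).1 dphi; have [sg _] := (diffeoP _ _ _).1 dg.
split=> //.
- by rewrite -(diffeo_image dphi); exact: smooth_connected sphi cD.
- by move=> c; exact: diffeo_foliation (fX c).
- move=> c d _ _ q cd [L XL <-] [M XM <-] [p Lp <-] [p' Mp' pp'] T.
  have Dp := LD _ _ XL _ Lp.
  have {}pp' : p' = p by apply: (diffeo_inj dphi) => //; exact: LD XM _ Mp'.
  rewrite {}pp' in Mp'; apply: (tX c d L M p cd XL XM Lp Mp').
  have tP A : A `<=` D -> A p ->
      tangent A p = [set v | tangent (phi @` A) (phi p) ('D_v phi p)].
    move=> AD Ap; apply/seteqP; split=> v /=.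
      by move=> tv; exact: (tangent_image oD sphi AD tv).
    have AD' : phi @` A `<=` D'.
      by rewrite -(diffeo_image dphi); exact: image_subset.
    have D'p : D' (phi p) by apply: AD'; exists p.
    move=> /(tangent_image oD' sg AD'); rewrite phiK// -(derive_comp _
      (smooth_differentiable sphi Dp) (smooth_differentiable sg D'p)).
    rewrite (derive_eq_on (g := id) v oD)// derive_id image_comp.
    rewrite (_ : (g \o phi) @` A = A)//; apply/seteqP; split=> [_ [r Ar <-]|r Ar].
      by rewrite /= phiK//; exact: AD.
    by exists r => //=; rewrite phiK//; exact: AD.
  by rewrite (tP L (LD _ _ XL) Lp) (tP M (LD _ _ XM) Mp') T.
- move=> c d _ _ cd [L XL <-] [M XM <-] x y.
  move=> [[p Lp px] [p' Mp' px']] [[r Lr ry] [r' Mr' ry']].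
  have pp' : p' = p.
    by apply: (diffeo_inj dphi); rewrite ?px'//;
      [exact: LD XM _ _|exact: LD XL _ _].
  have rr' : r' = r.
    by apply: (diffeo_inj dphi); rewrite ?ry'//;
      [exact: LD XM _ _|exact: LD XL _ _].
  rewrite -px -ry; congr phi; apply: (sX c d L M cd XL XM); split=> //.
    by rewrite -pp'.
  by rewrite -rr'.
Qed.

End WebTransport.

(** * Linear pencils of foliations *)

Section CubicIdentity.
Variable K : fieldType.
Implicit Types u v : K * K.

Lemma det2_eq0 (a1 a2 b1 b2 x y : K) : a1 * b2 - a2 * b1 != 0 ->
  x * a1 + y * a2 = 0 -> x * b1 + y * b2 = 0 -> x = 0 /\ y = 0.
Proof.
move=> d0 ha hb; split; apply: (mulIf d0); rewrite mul0r.
  have -> : x * (a1 * b2 - a2 * b1) =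
    (x * a1 + y * a2) * b2 - (x * b1 + y * b2) * a2 by ring.
  by rewrite ha hb !mul0r subr0.
have -> : y * (a1 * b2 - a2 * b1) =
  (x * b1 + y * b2) * a1 - (x * a1 + y * a2) * b1 by ring.
by rewrite ha hb !mul0r subr0.
Qed.

Definition bil u v (k11 k12 k21 k22 : K) : K :=
  u.1 * v.1 * k11 + u.1 * v.2 * k12 + u.2 * v.1 * k21 + u.2 * v.2 * k22.

(* With kij for d_i k_j, this is the derivative of v |-> k(v) along the kernel
   of the covector (k1, k2): it vanishes when the leaf of k = 0 is straight. *)
Definition bending (k1 k2 k11 k12 k21 k22 : K) : K :=
  bil (- k2, k1) (- k2, k1) k11 k12 k21 k22.

Variables a1 a2 b1 b2 a11 a12 a21 a22 b11 b12 b21 b22 c : K.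
(** [X] spans the kernel of b and [Y] that of a, while a(X) = b(Y) is the determinant. Divided by
    it, [X] and [Y] form the frame dual to (a, b), so a bilinear form is recovered from its values
    on them ([frame_expansion]). *)
Let X := (b2, - b1).
Let Y := (- a2, a1).

Definition frame_coef (z w x y : K) : K :=
  (z * x + w * y) / ((a1 * b2 - a2 * b1) * (a1 * b2 - a2 * b1)).

(** Write l and p in the coframe (a, b) and compare with [frame_expansion]. The equations b_ij = l_i
    b_j + p_j b_i and a_ij = l_i a_j + p_j a_i prescribe each coordinate once, through a mixed value
    on ([X], [Y]) or ([Y], [X]); the two remaining conditions are [bending_mixed]. *)
Definition lam1 :=
  frame_coef a1 b1 (bil X Y b11 b12 b21 b22) (bil Y X a11 a12 a21 a22).
Definition lam2 :=
  frame_coef a2 b2 (bil X Y b11 b12 b21 b22) (bil Y X a11 a12 a21 a22).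
Definition psi1 :=
  frame_coef a1 b1 (bil Y X b11 b12 b21 b22) (bil X Y a11 a12 a21 a22).
Definition psi2 :=
  frame_coef a2 b2 (bil Y X b11 b12 b21 b22) (bil X Y a11 a12 a21 a22).

Hypotheses (D0 : a1 * b2 - a2 * b1 != 0) (c0 : c != 0) (c1 : c != 1).
Hypothesis bendA : bending a1 a2 a11 a12 a21 a22 = 0.
Hypothesis bendB : bending b1 b2 b11 b12 b21 b22 = 0.
Hypothesis bendAB : bending (a1 + b1) (a2 + b2)
  (a11 + b11) (a12 + b12) (a21 + b21) (a22 + b22) = 0.
Hypothesis bendcAB : bending (c * a1 + b1) (c * a2 + b2)
  (c * a11 + b11) (c * a12 + b12) (c * a21 + b21) (c * a22 + b22) = 0.

(* The bending of x a + y b is a binary cubic form in (x, y) with the four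
   roots (1, 0), (0, 1), (1, 1), (c, 1), so its mixed coefficients vanish. *)
Lemma bending_mixed :
  bil Y Y b11 b12 b21 b22
    = bil X Y a11 a12 a21 a22 + bil Y X a11 a12 a21 a22 /\
  bil X X a11 a12 a21 a22
    = bil X Y b11 b12 b21 b22 + bil Y X b11 b12 b21 b22.
Proof.
set s1 := bil Y Y _ _ _ _; set s2 := _ + _.
(* The kernel of x a + y b is spanned by x [Y] - y [X], which makes [s] and [t] below the
   coefficients of x^2 y and x y^2. The root (1, 1) gives s + t = 0 and the root (c, 1) gives c (c s
   + t) = 0. *)
set t1 := bil X X _ _ _ _; set t2 := _ + _.
pose s := s1 - s2; pose t := t1 - t2.
have st : s + t = 0.
  transitivity (bending (a1 + b1) (a2 + b2)
      (a11 + b11) (a12 + b12) (a21 + b21) (a22 + b22)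
    - bending a1 a2 a11 a12 a21 a22 - bending b1 b2 b11 b12 b21 b22).
    by rewrite /s /t /s1 /s2 /t1 /t2 /bending /bil /=; ring.
  by rewrite bendAB bendA bendB !subr0.
have cst : c * s + t = 0.
  apply: (mulfI c0); rewrite mulr0.
  transitivity (bending (c * a1 + b1) (c * a2 + b2)
      (c * a11 + b11) (c * a12 + b12) (c * a21 + b21) (c * a22 + b22)
    - c ^+ 3 * bending a1 a2 a11 a12 a21 a22 - bending b1 b2 b11 b12 b21 b22).
    by rewrite /s /t /s1 /s2 /t1 /t2 /bending /bil /=; ring.
  by rewrite bendcAB bendA bendB mulr0 !subr0.
have s0 : s = 0.
  have c1' : c - 1 != 0 by rewrite subr_eq0.
  apply: (mulfI c1'); rewrite mulr0.
  have -> : (c - 1) * s = (c * s + t) - (s + t) by ring.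
  by rewrite cst st subr0.
split; apply/eqP; rewrite -subr_eq0; apply/eqP => //.
by move: st; rewrite s0 add0r.
Qed.

Lemma frame_expansion (k11 k12 k21 k22 : K) :
  let D2 := (a1 * b2 - a2 * b1) * (a1 * b2 - a2 * b1) in
  let xx := bil X X k11 k12 k21 k22 in let xy := bil X Y k11 k12 k21 k22 in
  let yx := bil Y X k11 k12 k21 k22 in let yy := bil Y Y k11 k12 k21 k22 in
  [/\ k11 * D2 = a1 * a1 * xx + a1 * b1 * xy + b1 * a1 * yx + b1 * b1 * yy,
      k12 * D2 = a1 * a2 * xx + a1 * b2 * xy + b1 * a2 * yx + b1 * b2 * yy,
      k21 * D2 = a2 * a1 * xx + a2 * b1 * xy + b2 * a1 * yx + b2 * b1 * yy &
      k22 * D2 = a2 * a2 * xx + a2 * b2 * xy + b2 * a2 * yx + b2 * b2 * yy].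
Proof. by rewrite /bil /=; split; ring. Qed.

Lemma covector_derivatives :
  [/\ a11 = lam1 * a1 + psi1 * a1, a12 = lam1 * a2 + psi2 * a1,
      a21 = lam2 * a1 + psi1 * a2 & a22 = lam2 * a2 + psi2 * a2] /\
  [/\ b11 = lam1 * b1 + psi1 * b1, b12 = lam1 * b2 + psi2 * b1,
      b21 = lam2 * b1 + psi1 * b2 & b22 = lam2 * b2 + psi2 * b2].
Proof.
have [mB mA] := bending_mixed.
have DD : (a1 * b2 - a2 * b1) * (a1 * b2 - a2 * b1) != 0 by rewrite mulf_neq0.
have cancel z w x y k : frame_coef z w x y * k
    * ((a1 * b2 - a2 * b1) * (a1 * b2 - a2 * b1)) = (z * x + w * y) * k.
  by rewrite /frame_coef mulrAC divfK.
have yyA : bil Y Y a11 a12 a21 a22 = 0 := bendA.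
have xxB : bil X X b11 b12 b21 b22 = 0.
  by rewrite -[RHS]bendB /bending /bil /=; ring.
have [A11 A12 A21 A22] := frame_expansion a11 a12 a21 a22.
have [B11 B12 B21 B22] := frame_expansion b11 b12 b21 b22.
rewrite /lam1 /lam2 /psi1 /psi2.
split; split; apply: (mulIf DD); rewrite [RHS]mulrDl !cancel.
- by rewrite A11 mA yyA; ring.
- by rewrite A12 mA yyA; ring.
- by rewrite A21 mA yyA; ring.
- by rewrite A22 mA yyA; ring.
- by rewrite B11 mB xxB; ring.
- by rewrite B12 mB xxB; ring.
- by rewrite B21 mB xxB; ring.
- by rewrite B22 mB xxB; ring.
Qed.

End CubicIdentity.

Section And4.
Variables P1 P2 P3 P4 : Prop.
Hypothesis h : [/\ P1, P2, P3 & P4].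
Lemma and4_1 : P1. Proof. by case: h. Qed.
Lemma and4_2 : P2. Proof. by case: h. Qed.
Lemma and4_3 : P3. Proof. by case: h. Qed.
Lemma and4_4 : P4. Proof. by case: h. Qed.
End And4.

(** * Integrability conditions of the projective system *)

Section ProjectiveSystem.
Variables (R : realType) (K : numFieldType) (e : real_parts R K).
Variables (D : set (plane K)) (oD : open D).
Implicit Types f g : plane K -> K.

Lemma deriveM_on f g v p : smooth D f -> smooth D g -> D p ->
  'D_v (fun q => f q * g q) p = f p * 'D_v g p + g p * 'D_v f p.
Proof.
by move=> sf sg Dp; rewrite deriveM//;
  [exact: smooth_derivable sf Dp|exact: smooth_derivable sg Dp].
Qed.

Lemma deriveD_on f g v p : smooth D f -> smooth D g -> D p ->
  'D_v (fun q => f q + g q) p = 'D_v f p + 'D_v g p.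
Proof.
by move=> sf sg Dp; rewrite deriveD//;
  [exact: smooth_derivable sf Dp|exact: smooth_derivable sg Dp].
Qed.

Lemma derive_mulc_on f (c : K) v p : smooth D f -> D p ->
  'D_v (fun q => f q * c) p = 'D_v f p * c.
Proof.
move=> sf Dp; rewrite (deriveM_on v sf (smooth_cst D c) Dp).
by rewrite (derive_cst c p v) mulr0 add0r mulrC.
Qed.

Local Notation D1 f := ('D_((1, 0) : plane K) f).
Local Notation D2 f := ('D_((0, 1) : plane K) f).

Lemma derive12 f q : smooth D f -> D q -> D1 (D2 f) q = D2 (D1 f) q.
Proof. by move=> sf Dq; exact: (derive_symmetric e _ _ oD Dq sf). Qed.

Section Curvature.
Variables p1 p2 F : plane K -> K.
Hypotheses (sp1 : smooth D p1) (sp2 : smooth D p2) (sF : smooth D F).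
Hypothesis dp : forall q, D q ->
  [/\ D1 p1 q = p1 q * p1 q, D2 p2 q = p2 q * p2 q,
      D2 p1 q = p1 q * p2 q + F q & D1 p2 q = p1 q * p2 q - F q].

(** Equality of the mixed derivatives of [p1] is the first equation, that of [p2] the second. *)
Lemma F_derivatives q : D q -> D1 F q = 3 * p1 q * F q /\ D2 F q = 3 * p2 q * F q.
Proof.
move=> Dq.
have e1 v := derive_eq_on v oD
   (fun q Dq => and4_1 (dp Dq)) Dq.
have e2 v := derive_eq_on v oD
   (fun q Dq => and4_2 (dp Dq)) Dq.
have e3 v := derive_eq_on v oD
   (fun q Dq => and4_3 (dp Dq)) Dq.
have e4 v := derive_eq_on v oD
   (fun q Dq => and4_4 (dp Dq)) Dq.
have := derive12 sp1 Dq.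
have := derive12 sp2 Dq.
have [h1 h2 h3 h4] := dp Dq.
have sNF : smooth D (fun q => - F q) by exact: smoothN.
rewrite e1 e2 e3 e4 !deriveD_on ?(deriveM_on _ sp1) ?(deriveM_on _ sp2)//;
  try exact: smoothM.
have -> : D2 (fun q => - F q) q = - D2 F q.
  by rewrite -deriveN//; exact: smooth_derivable sF Dq.
rewrite h1 h2 h3 h4 => /eqP; rewrite -subr_eq0 => /eqP E2.
move=> /eqP; rewrite -subr_eq0 => /eqP E1.
split; apply/eqP; rewrite -subr_eq0.
  by rewrite -[X in _ == X]E1; apply/eqP; ring.
by rewrite -[X in _ == X]E2; apply/eqP; ring.
Qed.

(** Cross-differentiating dF = 3 F p cancels everything except 3 F (d_1 p_2 - d_2 p_1), where the
    bracket is - 2 F. Hence 6 F^2 = 0, and [K] has characteristic zero. *)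
Lemma F_eq0 q : D q -> F q = 0.
Proof.
move=> Dq; have sc : smooth D (fun=> 3 : K) by exact: smooth_cst.
have e1 := derive_eq_on ((0, 1) : plane K) oD (fun q Dq => (F_derivatives Dq).1) Dq.
have e2 := derive_eq_on ((1, 0) : plane K) oD (fun q Dq => (F_derivatives Dq).2) Dq.
have := derive12 sF Dq.
have [h1 h2] := F_derivatives Dq; have [_ _ h3 h4] := dp Dq.
rewrite e1 e2 !(deriveM_on _ _ sF) ?(deriveM_on _ sc)//; try exact: smoothM.
rewrite h1 h2 h3 h4 !derive_cst => /eqP; rewrite -subr_eq0 => /eqP E.
have : 6 * F q ^+ 2 = 0 by rewrite -oppr0 -[in RHS]E; ring.
by move/eqP; rewrite mulf_eq0 pnatr_eq0 /= expf_eq0 /= => /eqP.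
Qed.

End Curvature.

Variables a1 a2 b1 b2 l1 l2 p1 p2 : plane K -> K.
Hypotheses (sa1 : smooth D a1) (sa2 : smooth D a2).
Hypotheses (sb1 : smooth D b1) (sb2 : smooth D b2).
Hypotheses (sl1 : smooth D l1) (sl2 : smooth D l2).
Hypotheses (sp1 : smooth D p1) (sp2 : smooth D p2).
Hypothesis ab0 : forall q, D q -> a1 q * b2 q - a2 q * b1 q != 0.
Hypothesis da : forall q, D q ->
  [/\ D1 a1 q = l1 q * a1 q + p1 q * a1 q, D1 a2 q = l1 q * a2 q + p2 q * a1 q,
      D2 a1 q = l2 q * a1 q + p1 q * a2 q & D2 a2 q = l2 q * a2 q + p2 q * a2 q].
Hypothesis db : forall q, D q ->
  [/\ D1 b1 q = l1 q * b1 q + p1 q * b1 q, D1 b2 q = l1 q * b2 q + p2 q * b1 q,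
      D2 b1 q = l2 q * b1 q + p1 q * b2 q & D2 b2 q = l2 q * b2 q + p2 q * b2 q].

(* d (l1 dx + l2 dy) = F dx dy; this is, up to a factor, the curvature form. *)
Let F q := D1 l2 q - D2 l1 q.

Let sF : smooth D F.
Proof. by apply: smoothB => //; exact: smooth_derive. Qed.

(** These are the equalities of mixed derivatives of [c1] and [c2]. Their coefficients do not depend
    on the covector (c1, c2), so two independent covectors force all four to vanish. *)
Lemma form_integrability (c1 c2 : plane K -> K) q :
  smooth D c1 -> smooth D c2 -> (forall q, D q ->
  [/\ D1 c1 q = l1 q * c1 q + p1 q * c1 q, D1 c2 q = l1 q * c2 q + p2 q * c1 q,
      D2 c1 q = l2 q * c1 q + p1 q * c2 q & D2 c2 q = l2 q * c2 q + p2 q * c2 q]) ->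
  D q ->
  [/\ (F q - (D2 p1 q - p1 q * p2 q)) * c1 q + (D1 p1 q - p1 q * p1 q) * c2 q = 0 &
   (- (D2 p2 q - p2 q * p2 q)) * c1 q + (F q + (D1 p2 q - p1 q * p2 q)) * c2 q = 0].
Proof.
move=> sc1 sc2 dc Dq.
have e1  v := derive_eq_on v oD
   (fun q Dq => and4_1 (dc q Dq)) Dq.
have e2  v := derive_eq_on v oD
   (fun q Dq => and4_2 (dc q Dq)) Dq.
have e3 v := derive_eq_on v oD
   (fun q Dq => and4_3 (dc q Dq)) Dq.
have e4 v := derive_eq_on v oD
   (fun q Dq => and4_4 (dc q Dq)) Dq.
have := derive12 sc1 Dq.
have := derive12 sc2 Dq.
have [h1 h2 h3 h4] := dc q Dq.
rewrite e1 e2 e3 e4 !deriveD_on ?(deriveM_on _ sl1) ?(deriveM_on _ sl2)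
  ?(deriveM_on _ sp1) ?(deriveM_on _ sp2)//; try exact: smoothM.
rewrite h1 h2 h3 h4 => /eqP; rewrite -subr_eq0 => /eqP E2.
move=> /eqP; rewrite -subr_eq0 => /eqP E1.
rewrite /F; move: E1 E2.
move: (D1 l2 q) (D2 l1 q) (D1 p1 q) (D2 p1 q) (D1 p2 q) (D2 p2 q).
move=> x1 x2 x3 x4 x5 x6 E1 E2.
by split; [rewrite -[RHS]E1|rewrite -[RHS]E2]; ring.
Qed.

Lemma psi_derivatives_F q : D q ->
  [/\ D1 p1 q = p1 q * p1 q, D2 p2 q = p2 q * p2 q,
      D2 p1 q = p1 q * p2 q + F q & D1 p2 q = p1 q * p2 q - F q].
Proof.
move=> Dq; have [E1 E2] := form_integrability sa1 sa2 da Dq.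
have [G1 G2] := form_integrability sb1 sb2 db Dq.
have [x1 y1] := det2_eq0 (ab0 Dq) E1 G1.
have [x2 y2] := det2_eq0 (ab0 Dq) E2 G2.
split; apply/eqP; rewrite -subr_eq0.
- by rewrite y1.
- by rewrite -oppr_eq0 x2.
- by rewrite -oppr_eq0 -[X in _ == X]x1; apply/eqP; ring.
- by rewrite -[X in _ == X]y2; apply/eqP; ring.
Qed.

Lemma psi_derivatives q : D q ->
  [/\ D1 p1 q = p1 q * p1 q, D2 p1 q = p2 q * p1 q,
      D1 p2 q = p1 q * p2 q & D2 p2 q = p2 q * p2 q].
Proof.
move=> Dq; have [-> -> -> ->] := psi_derivatives_F Dq.
rewrite (F_eq0 sp1 sp2 sF (fun q => @psi_derivatives_F q) Dq) subr0 addr0.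
by rewrite (mulrC (p2 q) (p1 q)).
Qed.

End ProjectiveSystem.

(** * The line of vertices *)

Section ConstantRatio.
Variables (R : realType) (K : numFieldType) (e : real_parts R K).
Variables (D : set (plane K)) (I : Type) (u : I -> plane K -> K).
Variables (l1 l2 : plane K -> K).
Hypotheses (oD : open D) (cD : connected D).
Hypothesis su : forall a, smooth D (u a).
Hypothesis du1 : forall a q, D q -> 'D_(1, 0) (u a) q = l1 q * u a q.
Hypothesis du2 : forall a q, D q -> 'D_(0, 1) (u a) q = l2 q * u a q.
Hypothesis u0 : forall q, D q -> exists a, u a q != 0.

(** Near [p] some [u c] has no zero. All [u a] share the logarithmic differential (l1, l2), so the
    quotients by [u c] have zero derivative on a ball. *)
Lemma locally_proportional p : D p -> exists c (r : K),
  [/\ 0 < r, ball p r `<=` D, u c p != 0 &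
    forall q, ball p r q -> u c q != 0 /\
      forall a, u a q * u c p = u c q * u a p].
Proof.
move=> Dp; have [c cp] := u0 Dp.
have cu : u c q @[q --> p] --> u c p := smooth_continuous (su c) Dp.
have nc : nbhs p [set q | u c q != 0] by exact: (cvgr_neq0 _ cu cp).
have N := @filterI _ _ (nbhs_filter p) _ _ (open_nbhs_nbhs (conj oD Dp)) nc.
have [r /= r0 pr] := (nbhs_ballP _ _).1 N.
exists c, r; split=> // [q /pr[]//|q pq]; have [Dq cq] := pr _ pq.
split=> // a; pose B := ball p r.
have oB : open B by exact: ball_open.
have BD : B `<=` D by move=> z /pr[].
have c0 z : B z -> u c z != 0 by move=> /pr[].
have sc := smooth_subset BD (su c); have sa := smooth_subset BD (su a).
have sV := smoothV oB c0 sc.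
have dz v (l : plane K -> K) z : B z -> 'D_v (u c) z = l z * u c z ->
    'D_v (u a) z = l z * u a z -> 'D_v (fun q => u a q * (u c q)^-1) z = 0.
  move=> Bz dc da; rewrite (deriveM_on v sa sV Bz) da.
  rewrite (deriveV (c0 _ Bz)) ?dc; last exact: smooth_derivable sc Bz.
  by rewrite /GRing.scale /=; field; exact: c0.
have E : u a q * (u c q)^-1 = u a p * (u c p)^-1.
  apply: (@ball_derive0 _ _ e (fun q => u a q * (u c q)^-1) p q r) => // z Bz.
  have Dz := BD _ Bz; split.
  - exact: (smooth_differentiable (smoothM oB sa sV) Bz).
  - by apply: (dz _ l1) => //; [exact: du1|exact: du1].
  - by apply: (dz _ l2) => //; [exact: du2|exact: du2].
apply: (mulIf (invr_neq0 cq)); rewrite mulrAC E mulfVK//.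
by rewrite mulrAC mulfV// mul1r.
Qed.

(** The nonvanishing index changes from ball to ball, hence the cross-multiplied form. The set [B]
    of points whose values are proportional to those at [p0] contains, with each small ball, all of
    its points or none, so it is open and closed in the connected set [D]. *)
Lemma ratio_constant p p0 a b : D p -> D p0 ->
  u a p * u b p0 = u b p * u a p0.
Proof.
move=> Dp Dp0.
pose B := [set q | D q /\ forall a b, u a q * u b p0 = u b q * u a p0].
have loc p1 : D p1 -> exists2 r : K, 0 < r &
    forall q, ball p1 r q -> B q <-> B p1.
  move=> Dp1; have [c [r [r0 rD c1 rq]]] := locally_proportional Dp1.
  exists r => // q pq; have [cq E] := rq _ pq.
  split=> -[_ H].
    split=> // a' b'; apply: (mulfI cq).
    by rewrite !mulrA -!E ![_ * u c p1]mulrC -!mulrA H.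
  split=> [|a' b']; first exact: rD.
  apply: (mulfI c1).
  by rewrite !mulrA ![u c p1 * _]mulrC !E -!mulrA H.
suff BD : B = D by move: Dp; rewrite -BD => -[_ ->].
apply: cD.
- by exists p0; split=> // a' b'; rewrite mulrC.
- exists B; last by apply/esym/setIidPr => q [].
  rewrite openE => q Bq; have [Dq _] := Bq; have [r r0 rB] := loc _ Dq.
  by apply/nbhs_ballP; exists r => // z /rB[_]; exact.
- exists (closure B); first exact: closed_closure.
  apply/seteqP; split=> [q Bq|q [Dq cq]].
    by split; [case: Bq|exact: subset_closure].
  have [r r0 rB] := loc _ Dq.
  have [z [Bz qz]] := cq _ (nbhsx_ballx q r r0).
  exact: ((rB z qz).1 Bz).
Qed.

End ConstantRatio.

(** * The fixed line and the normals of the image leaves *)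

Section Projection.
Variables (R : realType) (K : numFieldType) (e : real_parts R K).
Variables (D : set (plane K)) (o : plane K).
Hypotheses (oD : open D) (cD : connected D) (Dp0 : D o).
Implicit Types f g : plane K -> K.

Local Notation D1 f := ('D_((1, 0) : plane K) f).
Local Notation D2 f := ('D_((0, 1) : plane K) f).

Lemma smooth_coord1 (U : set (plane K)) : open U -> smooth U (fun q => q.1).
Proof. by move=> oU; exact: smooth_fst oU (smooth_id U). Qed.

Lemma smooth_coord2 (U : set (plane K)) : open U -> smooth U (fun q => q.2).
Proof. by move=> oU; exact: smooth_snd oU (smooth_id U). Qed.

Lemma derive_coord1 (v q : plane K) c : 'D_v (fun z : plane K => z.1 - c) q = v.1.
Proof.
rewrite deriveB; [|exact/diff_derivable/differentiable_fst|exact: derivable_cst].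
rewrite derive_cst subr0 (@derive_fst K (plane K) id) ?derive_id//.
Qed.

Lemma derive_coord2 (v q : plane K) c : 'D_v (fun z : plane K => z.2 - c) q = v.2.
Proof.
rewrite deriveB; [|exact/diff_derivable/differentiable_snd|exact: derivable_cst].
rewrite derive_cst subr0 (@derive_snd K (plane K) id) ?derive_id//.
Qed.

Variables p1 p2 : plane K -> K.
Hypotheses (sp1 : smooth D p1) (sp2 : smooth D p2).
Hypothesis dp : forall q, D q ->
  [/\ D1 p1 q = p1 q * p1 q, D2 p1 q = p2 q * p1 q,
      D1 p2 q = p1 q * p2 q & D2 p2 q = p2 q * p2 q].

Let x1 (q : plane K) := q.1 - o.1.
Let x2 (q : plane K) := q.2 - o.2.

Let sx1 : smooth D x1.
Proof. by apply: smoothB => //; [exact: smooth_coord1|exact: smooth_cst]. Qed.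

Let sx2 : smooth D x2.
Proof. by apply: smoothB => //; [exact: smooth_coord2|exact: smooth_cst]. Qed.

Let u q := 1 + (p1 q * x1 q + p2 q * x2 q).

Let su : smooth D u.
Proof.
by apply: smoothD => //; [exact: smooth_cst|apply: smoothD => //; exact: smoothM].
Qed.

Let du v q : D q ->
  'D_v u q = 'D_v p1 q * x1 q + v.1 * p1 q + ('D_v p2 q * x2 q + v.2 * p2 q).
Proof.
move=> Dq; have s1 := smoothM oD sp1 sx1; have s2 := smoothM oD sp2 sx2.
rewrite /u (deriveD_on _ (smooth_cst D (1 : K)) (smoothD oD s1 s2) Dq).
rewrite derive_cst add0r.
rewrite (deriveD_on _ s1 s2 Dq) (deriveM_on _ sp1 sx1 Dq) (deriveM_on _ sp2 sx2 Dq).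
by rewrite /x1 /x2 derive_coord1 derive_coord2; ring.
Qed.

(* The homogeneous coordinates (p1, p2, u) of the line at which the pencils of
   the web have their vertices all have the same logarithmic differential. *)
Lemma psi_proportional q : D q ->
  p1 q = p1 o * u q /\ p2 q = p2 o * u q.
Proof.
move=> Dq; pose U (i : option bool) : plane K -> K :=
  if i is Some b then if b then p1 else p2 else u.
have sU i : smooth D (U i) by case: i => [[]|].
have d1 i z : D z -> D1 (U i) z = p1 z * U i z.
  move=> Dz; have [h1 _ h3 _] := dp Dz; case: i => [[]|] //=.
  by rewrite du// h1 h3 /= /u; ring.
have d2 i z : D z -> D2 (U i) z = p2 z * U i z.
  move=> Dz; have [_ h2 _ h4] := dp Dz; case: i => [[]|] //=.
  by rewrite du// h2 h4 /= /u; ring.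
have U0 z : D z -> exists i, U i z != 0.
  move=> Dz; have [E1|n1] := eqVneq (p1 z) 0; last by exists (Some true).
  have [E2|n2] := eqVneq (p2 z) 0; last by exists (Some false).
  by exists None; rewrite /= /u E1 E2 !mul0r !addr0 oner_eq0.
have H a := ratio_constant e oD cD sU d1 d2 U0 a None Dq Dp0.
have u1 : u o = 1 by rewrite /u /x1 /x2 !subrr !mulr0 !addr0.
have := H (Some true); have := H (Some false); rewrite /= u1 !mulr1 => -> ->.
by rewrite ![_ * u q]mulrC.
Qed.

(** Its zero set is the line of vertices: p(q)(z - q) = 1 is the same line for every q in [D],
    written here for q = [o]. By [denominator_inv] its values on [D] are invertible, so [D] misses
    the line. *)
Definition denominator (q : plane K) : K := 1 - (p1 o * x1 q + p2 o * x2 q).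

Lemma denominator_inv q : D q -> u q * denominator q = 1.
Proof.
move=> Dq; have [h1 h2] := psi_proportional Dq.
rewrite /denominator mulrBr mulr1 mulrDr !mulrA ![u q * _]mulrC -h1 -h2 /u.
by ring.
Qed.

Lemma denominator_neq0 q : D q -> denominator q != 0.
Proof.
move=> Dq; apply/eqP => d0; have := denominator_inv Dq.
by rewrite d0 mulr0 => /eqP; rewrite eq_sym oner_eq0.
Qed.

Variables k1 k2 l1 l2 : plane K -> K.
Hypotheses (sk1 : smooth D k1) (sk2 : smooth D k2).
Hypothesis dk : forall q, D q ->
  [/\ D1 k1 q = l1 q * k1 q + p1 q * k1 q, D1 k2 q = l1 q * k2 q + p2 q * k1 q,
      D2 k1 q = l2 q * k1 q + p1 q * k2 q & D2 k2 q = l2 q * k2 q + p2 q * k2 q].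
Hypothesis k0 : forall q, D q -> (k1 q != 0) || (k2 q != 0).

Let kx q := k1 q * x1 q + k2 q * x2 q.
(** With s = p(o), X = x / (1 - s x) and x = X / (1 + s X), the line k x = [kx] becomes (k - [kx] s)
    X = [kx]. So this covector is the normal of the image leaf; equivalently, it is the normal of
    the line joining [o] to the vertex. *)
Definition image_form1 q := k1 q - kx q * p1 o.
Definition image_form2 q := k2 q - kx q * p2 o.

Let skx : smooth D kx.
Proof. by apply: smoothD => //; exact: smoothM. Qed.

Let dimage v q (k : plane K -> K) (c : K) : D q -> smooth D k ->
  'D_v (fun q => k q - kx q * c) q = 'D_v k q
    - ('D_v k1 q * x1 q + v.1 * k1 q + ('D_v k2 q * x2 q + v.2 * k2 q)) * c.
Proof.
move=> Dq sk; have s1 := smoothM oD sk1 sx1; have s2 := smoothM oD sk2 sx2.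
have sc : smooth D (fun=> - c) by exact: smooth_cst.
have -> : (fun q => k q - kx q * c) = (fun q => k q + kx q * - c).
  by apply/funext => z; rewrite mulrN.
rewrite (deriveD_on _ sk (smoothM oD skx sc) Dq) (deriveM_on _ skx sc Dq).
rewrite derive_cst mulr0 add0r /kx.
rewrite (deriveD_on _ s1 s2 Dq) (deriveM_on _ sk1 sx1 Dq) (deriveM_on _ sk2 sx2 Dq).
by rewrite /x1 /x2 derive_coord1 derive_coord2; ring.
Qed.

(** Contracting the image form with [q - o] gives [kx] times the denominator. If the form vanished,
    [kx] would too, and the form would reduce to k. *)
Lemma image_form_neq0 q : D q -> (image_form1 q != 0) || (image_form2 q != 0).
Proof.
move=> Dq; apply: contraT; rewrite negb_or !negbK => /andP[/eqP e1 /eqP e2].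
have kxd : kx q * denominator q = 0.
  transitivity (image_form1 q * x1 q + image_form2 q * x2 q); last first.
    by rewrite e1 e2; ring.
  by rewrite /image_form1 /image_form2 /denominator /kx; ring.
have kx0 : kx q = 0.
  by apply: (mulIf (denominator_neq0 Dq)); rewrite kxd mul0r.
move: e1 e2 (k0 Dq); rewrite /image_form1 /image_form2 kx0 !mul0r !subr0 => -> ->.
by rewrite eqxx.
Qed.

(** The derivative d_i of the image form is l_i times itself plus k_i (p - p(o) u), and the last
    term vanishes by [psi_proportional]. So both components have the logarithmic differential l and
    a constant ratio; at [o] the form is k. *)
Lemma image_form_direction q : D q -> image_form1 q * k2 o = image_form2 q * k1 o.
Proof.
move=> Dq; pose U (b : bool) := if b then image_form1 else image_form2.
have sU b : smooth D (U b).
  by case: b; apply: smoothB => //; apply: smoothM => //; exact: smooth_cst.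
have d1 i z : D z -> D1 (U i) z = l1 z * U i z.
  move=> Dz; have [h1 h2 _ _] := dk Dz; have [e1 e2] := psi_proportional Dz.
  case: i; rewrite /U /image_form1 /image_form2 dimage// h1 h2 /=.
    transitivity (l1 z * (k1 z - kx z * p1 o) + k1 z * (p1 z - p1 o * u z)).
      by rewrite /kx /u; ring.
    by rewrite -e1; ring.
  transitivity (l1 z * (k2 z - kx z * p2 o) + k1 z * (p2 z - p2 o * u z)).
    by rewrite /kx /u; ring.
  by rewrite -e2; ring.
have d2 i z : D z -> D2 (U i) z = l2 z * U i z.
  move=> Dz; have [_ _ h3 h4] := dk Dz; have [e1 e2] := psi_proportional Dz.
  case: i; rewrite /U /image_form1 /image_form2 dimage// h3 h4 /=.
    transitivity (l2 z * (k1 z - kx z * p1 o) + k2 z * (p1 z - p1 o * u z)).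
      by rewrite /kx /u; ring.
    by rewrite -e1; ring.
  transitivity (l2 z * (k2 z - kx z * p2 o) + k2 z * (p2 z - p2 o * u z)).
    by rewrite /kx /u; ring.
  by rewrite -e2; ring.
have U0 z : D z -> exists i, U i z != 0.
  by move=> /image_form_neq0/orP[n|n]; [exists true|exists false].
have := ratio_constant e oD cD sU d1 d2 U0 true false Dq Dp0.
rewrite /= /image_form1 /image_form2 /kx /x1 /x2.
by rewrite !subrr !mulr0 !addr0 !mul0r !subr0.
Qed.

End Projection.

(** * Straight leaves *)

Section TangentLines.
Variable K : numFieldType.
Implicit Types (L D : set (plane K)) (p q v z : plane K).

Lemma tangent_derive0 L q z (f : plane K -> K) : tangent L q z ->
  differentiable f q -> (forall y, L y -> f y = 0) -> 'D_z f q = 0.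
Proof.
move=> [I [h [[oI I0 sh] [hL h0 dh]]]] df fL; rewrite -h0 in df.
have hI t : I t -> f (h t) = cst 0 t by move=> It; apply: fL; apply: hL; exists t.
have := derive_eq_on (1 : K) oI hI I0.
rewrite derive_cst (derive_comp _ (smooth_differentiable sh I0) df).
by rewrite -derive1E dh h0.
Qed.

Lemma tangent_line L q z p v : tangent L q z -> L `<=` line p v ->
  v.1 * z.2 = v.2 * z.1.
Proof.
move=> Lz Lpv; have oT : open (setT : set (plane K)) := openT.
have s1 : smooth setT (fun y : plane K => y.1 - p.1).
  by apply: smoothB => //; [exact: smooth_coord1|exact: smooth_cst].
have s2 : smooth setT (fun y : plane K => y.2 - p.2).
  by apply: smoothB => //; [exact: smooth_coord2|exact: smooth_cst].
have sc (c : K) : smooth setT (fun _ : plane K => c) by exact: smooth_cst.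
have sf := smoothD oT (smoothM oT (sc v.1) s2) (smoothM oT (sc (- v.2)) s1).
have df := smooth_differentiable sf (I : setT q).
apply/eqP; rewrite -subr_eq0; apply/eqP.
rewrite -[RHS](tangent_derive0 Lz df); last first.
  by move=> y /Lpv[s ->]; rewrite -[s *: v]/(s * v.1, s * v.2) /=; ring.
rewrite (deriveD_on _ (smoothM oT (sc v.1) s2) (smoothM oT (sc (- v.2)) s1) I).
rewrite (deriveM_on _ (sc v.1) s2 I) (deriveM_on _ (sc (- v.2)) s1 I).
by rewrite !derive_cst derive_coord1 derive_coord2; ring.
Qed.

Lemma colinear (v z : plane K) : v != 0 -> v.1 * z.2 = v.2 * z.1 ->
  exists m, z = m *: v.
Proof.
case: v z => v1 v2 [z1 z2] /= v0 E; have [v10|v10] := eqVneq v1 0.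
  have v20 : v2 != 0 by apply: contra v0 => /eqP->; rewrite v10.
  exists (z2 / v2); rewrite -[_ *: _]/(z2 / v2 * v1, z2 / v2 * v2).
  rewrite divfK// v10 mulr0.
  by congr pair; apply: (mulfI v20); rewrite -E v10 mul0r mulr0.
exists (z1 / v1); rewrite -[_ *: _]/(z1 / v1 * v1, z1 / v1 * v2) divfK//.
by congr pair; apply: (mulfI v10); rewrite E; field.
Qed.

Lemma orthogonal_colinear (c1 c2 : K) (z : plane K) : (c1 != 0) || (c2 != 0) ->
  c1 * z.1 + c2 * z.2 = 0 -> exists t, z = t *: ((- c2, c1) : plane K).
Proof.
move=> c0 cz; apply: colinear.
  apply: contraL c0 => /eqP[/eqP]; rewrite oppr_eq0 => /eqP-> ->.
  by rewrite eqxx.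
by apply/eqP; rewrite -subr_eq0 /= -oppr_eq0 -[X in _ == X]cz; apply/eqP; ring.
Qed.

(** On a straight leaf [v] is constant, so differentiating k(v) = 0 along m v only touches the
    coefficients of k. As v = t (- k2, k1), the result is the bending times m t t. *)
Lemma straight_bending v (m k1 k2 k11 k12 k21 k22 : K) : v != 0 -> m != 0 ->
  (k1 != 0) || (k2 != 0) -> k1 * v.1 + k2 * v.2 = 0 ->
  (m *: v).1 *: (k11 * v.1 + k12 * v.2) + (m *: v).2 *: (k21 * v.1 + k22 * v.2)
    = 0 -> bending k1 k2 k11 k12 k21 k22 = 0.
Proof.
move=> v0 m0 k0 kv.
rewrite -[m *: v]/(m * v.1, m * v.2) /GRing.scale /= => E.
have [t vt] := orthogonal_colinear k0 kv.
have t0 : t != 0 by apply: contra v0 => /eqP t0; rewrite vt t0 scale0r.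
have v1 : v.1 = t * - k2 by rewrite vt.
have v2 : v.2 = t * k1 by rewrite vt.
have mt : m * (t * t) != 0 by rewrite !mulf_neq0.
apply: (mulfI mt); rewrite mulr0 -[RHS]E v1 v2 /bending /bil /=.
by ring.
Qed.

End TangentLines.

(** * Pulling the forms back to the linear web *)

Section Pullback.
Variable K : numFieldType.
Variables (D D' : set (plane K)) (phi g : plane K -> plane K).
Variables (w0 w1 : one_form K).
Hypotheses (oD : open D) (oD' : open D').
Hypotheses (sphi : smooth D phi) (sg : smooth D' g).
Hypothesis phiK : forall p, D p -> D' (phi p) /\ g (phi p) = p.
Hypothesis gK : forall q, D' q -> D (g q) /\ phi (g q) = q.
Hypotheses (sw0 : smooth D w0) (sw1 : smooth D w1).

(** The pullback of [w] under [g], evaluated on [v]; the directions [(1, 0)] and [(0, 1)] give its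
    coefficients. *)
Definition pull (w : one_form K) (v q : plane K) : K :=
  pairing w (g q) ('D_v g q).

Lemma smooth_pull w v : smooth D w -> smooth D' (pull w v).
Proof.
move=> sw; have gD q : D' q -> D (g q) by move=> /gK[].
have s1 := smooth_comp oD' gD sg (smooth_fst oD sw).
have s2 := smooth_comp oD' gD sg (smooth_snd oD sw).
have sd := smooth_derive v sg.
exact: (smoothD oD' (smoothM oD' s1 (smooth_fst oD' sd))
  (smoothM oD' s2 (smooth_snd oD' sd))).
Qed.

Lemma pull_pairing w v q : D' q ->
  pull w (1, 0) q * v.1 + pull w (0, 1) q * v.2 = pairing w (g q) ('D_v g q).
Proof.
move=> Dq; rewrite (diff_plane v (smooth_differentiable sg Dq)) /pull.
rewrite /pairing; move: ('D_(1, 0) g q) ('D_(0, 1) g q) (w (g q)).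
move=> [d11 d12] [d21 d22] [c1 c2]; case: v => v1 v2.
rewrite -[(v1, v2).1 *: _]/(v1 * d11, v1 * d12).
rewrite -[(v1, v2).2 *: _]/(v2 * d21, v2 * d22) /=.
by ring.
Qed.

Lemma derive_gphi v p : D p -> 'D_('D_v phi p) g (phi p) = v.
Proof.
move=> Dp; have [D'p gp] := phiK Dp.
rewrite -(derive_comp _ (smooth_differentiable sphi Dp)
  (smooth_differentiable sg D'p)).
rewrite (derive_eq_on (g := id) v oD) ?derive_id// => z Dz.
by have [] := phiK Dz.
Qed.

Lemma derive_phig v q : D' q -> 'D_('D_v g q) phi (g q) = v.
Proof.
move=> Dq; have [D'p gp] := gK Dq.
rewrite -(derive_comp _ (smooth_differentiable sg Dq)
  (smooth_differentiable sphi D'p)).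
rewrite (derive_eq_on (g := id) v oD') ?derive_id// => z Dz.
by have [] := gK Dz.
Qed.

(** The determinant is multiplied by the Jacobian of [g], which is nonzero because its product with
    that of [phi] is 1. *)
Lemma pull_det q : D' q ->
  (w0 (g q)).1 * (w1 (g q)).2 - (w0 (g q)).2 * (w1 (g q)).1 != 0 ->
  pull w0 (1, 0) q * pull w1 (0, 1) q - pull w0 (0, 1) q * pull w1 (1, 0) q != 0.
Proof.
move=> Dq d0; have [Dg _] := gK Dq.
have E1 := derive_phig (1, 0) Dq; have E2 := derive_phig (0, 1) Dq.
rewrite (diff_plane _ (smooth_differentiable sphi Dg)) in E1.
rewrite (diff_plane _ (smooth_differentiable sphi Dg)) in E2.
rewrite /pull /pairing.
move: ('D_(1, 0) g q) ('D_(0, 1) g q) E1 E2.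
move: ('D_(1, 0) phi (g q)) ('D_(0, 1) phi (g q)).
move=> [n11 n12] [n21 n22] [m11 m12] [m21 m22] /= E1 E2.
have [e11 e12] : (m11 * n11 + m12 * n21, m11 * n12 + m12 * n22) = (1, 0) := E1.
have [e21 e22] : (m21 * n11 + m22 * n21, m21 * n12 + m22 * n22) = (0, 1) := E2.
have dm : (m11 * m22 - m12 * m21) * (n11 * n22 - n12 * n21) = 1.
  transitivity ((m11 * n11 + m12 * n21) * (m21 * n12 + m22 * n22)
    - (m11 * n12 + m12 * n22) * (m21 * n11 + m22 * n21)); first by ring.
  by rewrite e11 e12 e21 e22 mul0r subr0 mulr1.
have m0 : m11 * m22 - m12 * m21 != 0.
  by apply/eqP => m0; move/eqP: dm; rewrite m0 mul0r eq_sym oner_eq0.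
move: (mulf_neq0 d0 m0); congr (_ != 0); ring.
Qed.

Section OneFoliation.
Variables (F : set (set (plane K))) (x y : K).
Hypothesis FD : forall L, F L -> L `<=` D.
Hypothesis FT : forall L p, F L -> L p ->
  tangent L p = [set v | x * pairing w0 p v + y * pairing w1 p v = 0].
Hypothesis Flin : forall L, F L -> exists p v, v != 0 /\ phi @` L `<=` line p v.

Definition pencil_form (v q : plane K) : K := x * pull w0 v q + y * pull w1 v q.

Lemma leaf_direction L p q v : F L -> v != 0 -> phi @` L `<=` line p v ->
  L q -> pencil_form (1, 0) (phi q) * v.1 + pencil_form (0, 1) (phi q) * v.2 = 0 /\
  exists2 m, m != 0 & tangent (phi @` L) (phi q) (m *: v).
Proof.
move=> FL v0 lin Lq; have Dq := FD FL Lq; have [Dq' gq] := phiK Dq.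
pose c1 := x * (w0 q).1 + y * (w1 q).1; pose c2 := x * (w0 q).2 + y * (w1 q).2.
have [z z0 zT] : exists2 z : plane K, z != 0 & tangent L q z.
  (* A nonzero tangent vector is needed to compare with [v]. Where the covector vanishes every
     vector is tangent, so any nonzero one will do. *)
  rewrite (FT FL Lq) /=; have [c0|c0] := eqVneq ((c1, c2) : plane K) 0.
    exists (1, 0); first by apply/eqP => -[/eqP]; rewrite oner_eq0.
    have [e1 e2] : (c1, c2) = (0, 0) := c0.
    by rewrite /pairing /= !mulr1 !mulr0 !addr0 -/c1 e1.
  exists (- c2, c1).
    by apply: contra c0 => /eqP[/eqP]; rewrite oppr_eq0 => /eqP-> ->.
  by rewrite /pairing /= /c1 /c2; ring.
have zT' := tangent_image oD sphi (FD FL) zT.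
have [m Em] := colinear v0 (tangent_line zT' lin).
(* Otherwise the differential of [phi] would kill [z], but that of [g] brings [z] back. *)
have m0 : m != 0.
  apply: contra z0 => /eqP m0; rewrite -(derive_gphi z Dq) Em m0 scale0r.
  by rewrite derive0.
split; last by exists m => //; rewrite -Em.
have dgv : 'D_v g (phi q) = m^-1 *: z.
  rewrite -(derive_gphi z Dq) Em.
  have dg := smooth_differentiable sg Dq'.
  by rewrite !deriveE// linearZ scalerA mulVf// scale1r.
transitivity (x * (pull w0 (1, 0) (phi q) * v.1 + pull w0 (0, 1) (phi q) * v.2)
  + y * (pull w1 (1, 0) (phi q) * v.1 + pull w1 (0, 1) (phi q) * v.2)).
  rewrite /pencil_form; move: (pull w0 (1, 0) (phi q)) (pull w0 (0, 1) (phi q)).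
  by move: (pull w1 (1, 0) (phi q)) (pull w1 (0, 1) (phi q)) => *; ring.
rewrite !pull_pairing// gq dgv; move: zT; rewrite (FT FL Lq) /= => E.
rewrite -[m^-1 *: z]/(m^-1 * z.1, m^-1 * z.2).
transitivity (m^-1 * (x * pairing w0 q z + y * pairing w1 q z)).
  by rewrite /pairing; move: (w0 q) (w1 q) z.1 z.2 => [? ?] [? ?] * /=; ring.
by rewrite E mulr0.
Qed.

(** The function obtained by applying the pencil form to the fixed vector [v] vanishes on the image
    leaf, hence its derivative in the tangent direction m v is zero. *)
Lemma bending_leaf L q : F L -> L q ->
  (pencil_form (1, 0) (phi q) != 0) || (pencil_form (0, 1) (phi q) != 0) ->
  bending (pencil_form (1, 0) (phi q)) (pencil_form (0, 1) (phi q))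
    ('D_(1, 0) (pencil_form (1, 0)) (phi q))
    ('D_(1, 0) (pencil_form (0, 1)) (phi q))
    ('D_(0, 1) (pencil_form (1, 0)) (phi q))
    ('D_(0, 1) (pencil_form (0, 1)) (phi q)) = 0.
Proof.
move=> FL Lq k0; have [p [v [v0 lin]]] := Flin FL.
have Dq := FD FL Lq; have [Dq' gq] := phiK Dq.
have [kv [m m0 mT]] := leaf_direction FL v0 lin Lq.
have sk z : smooth D' (pencil_form z).
  have sc (c : K) : smooth D' (fun _ : plane K => c) by exact: smooth_cst.
  exact: (smoothD oD' (smoothM oD' (sc x) (smooth_pull z sw0))
    (smoothM oD' (sc y) (smooth_pull z sw1))).
have sc (c : K) : smooth D' (fun _ : plane K => c) by exact: smooth_cst.
have s1 := smoothM oD' (sk (1, 0)) (sc v.1).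
have s2 := smoothM oD' (sk (0, 1)) (sc v.2).
have sf := smoothD oD' s1 s2; have df := smooth_differentiable sf Dq'.
have f0 : forall y, (phi @` L) y ->
    pencil_form (1, 0) y * v.1 + pencil_form (0, 1) y * v.2 = 0.
  by move=> _ [r Lr <-]; have [] := leaf_direction FL v0 lin Lr.
have := tangent_derive0 mT df f0; rewrite (diff_plane _ df).
have dv z :
    'D_z (fun q => pencil_form (1, 0) q * v.1 + pencil_form (0, 1) q * v.2) (phi q)
    = 'D_z (pencil_form (1, 0)) (phi q) * v.1
      + 'D_z (pencil_form (0, 1)) (phi q) * v.2.
  rewrite (deriveD_on _ s1 s2 Dq') (derive_mulc_on _ _ (sk (1, 0)) Dq').
  by rewrite (derive_mulc_on _ _ (sk (0, 1)) Dq').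
rewrite !dv => E; exact: (straight_bending v0 m0 k0 kv E).
Qed.

End OneFoliation.
End Pullback.

(** * The projective transformation *)

Section ProjectiveMap.
Variables (K : numFieldType) (o : plane K) (s1 s2 : K).
Implicit Types p q v : plane K.

Let den q := 1 - (s1 * (q.1 - o.1) + s2 * (q.2 - o.2)).

Definition projmap q : plane K :=
  ((q.1 - o.1) * (den q)^-1, (q.2 - o.2) * (den q)^-1).

(** Evaluated at the image point, this is the inverse of [den], which is why multiplying by its
    inverse and adding [o] undoes [projmap]. *)
Let iden q := 1 + (s1 * q.1 + s2 * q.2).

Let invmap q : plane K := (o.1 + q.1 * (iden q)^-1, o.2 + q.2 * (iden q)^-1).

Lemma open_neq0 (f : plane K -> K) : smooth setT f -> open [set q | f q != 0].
Proof.
move=> sf; rewrite openE => q fq0.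
have cf : f z @[z --> q] --> f q := smooth_continuous sf I.
exact: (cvgr_neq0 _ cf fq0).
Qed.

Let smooth_sub1 : smooth setT (fun q => q.1 - o.1).
Proof.
by apply: (smoothB openT); [exact: (smooth_coord1 openT)|exact: smooth_cst].
Qed.

Let smooth_sub2 : smooth setT (fun q => q.2 - o.2).
Proof.
by apply: (smoothB openT); [exact: (smooth_coord2 openT)|exact: smooth_cst].
Qed.

Let smooth_c (c : K) : smooth setT (fun _ : plane K => c).
Proof. exact: smooth_cst. Qed.

Let smooth_den : smooth setT den.
Proof.
apply: (smoothB openT); first exact: smooth_c.
by apply: (smoothD openT); apply: (smoothM openT).
Qed.

Let smooth_iden : smooth setT iden.
Proof.
apply: (smoothD openT); first exact: smooth_c.
by apply: (smoothD openT); apply: (smoothM openT) => //;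
  [exact: (smooth_coord1 openT)|exact: (smooth_coord2 openT)].
Qed.

Lemma open_den : open [set q | den q != 0].
Proof. exact: open_neq0. Qed.

Lemma open_iden : open [set q | iden q != 0].
Proof. exact: open_neq0. Qed.

Lemma diffeo_projmap :
  diffeo [set q | den q != 0] [set q | iden q != 0] projmap.
Proof.
have o1 := open_den; have o2 := open_iden.
have subT (U : set (plane K)) (f : plane K -> K) : smooth setT f -> smooth U f.
  by move=> sf; exact: smooth_subset sf.
apply/diffeoP; split.
  have sV := smoothV o1 (fun q (h : den q != 0) => h) (subT _ _ smooth_den).
  by apply: (smooth_pair o1); apply: (smoothM o1) => //; exact: subT.
exists invmap; split.
- have sV := smoothV o2 (fun q (h : iden q != 0) => h) (subT _ _ smooth_iden).
  by apply: (smooth_pair o2); apply: (smoothD o2); try exact: smooth_cst;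
    apply: (smoothM o2) => //;
    [exact: (smooth_coord1 o2)|exact: (smooth_coord2 o2)].
- move=> q /= q0.
  have E : iden (projmap q) = (den q)^-1.
    have : s1 * (q.1 - o.1) + s2 * (q.2 - o.2) = 1 - den q by rewrite /den; ring.
    rewrite /iden /projmap /=; move: (den q) q0 => d d0 sd.
    transitivity (1 + (s1 * (q.1 - o.1) + s2 * (q.2 - o.2)) / d); first by ring.
    by rewrite sd; field.
  split; first by rewrite E invr_eq0.
  rewrite /invmap E invrK /= !divfK//.
  by case: q {q0 E} => q1 q2 /=; congr pair; ring.
- move=> q /= q0.
  have E : den (invmap q) = (iden q)^-1.
    have : s1 * q.1 + s2 * q.2 = iden q - 1 by rewrite /iden; ring.
    rewrite /den /invmap /=; move: (iden q) q0 => d d0 sd.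
    transitivity (1 - (s1 * q.1 + s2 * q.2) / d); first by ring.
    by rewrite sd; field.
  split; first by rewrite E invr_eq0.
  rewrite /projmap E invrK /= ![_ + _ - _]addrAC !subrr !add0r !divfK//.
  by case: q {q0 E}.
Qed.

(** The chord between the images is annihilated by (h1, h2), and (c1, c2) is a covector proportional
    to it that will be the same for all leaves. *)
Lemma projmap_line q q' v (s k1 k2 c1 c2 : K) :
  let kx := k1 * (q.1 - o.1) + k2 * (q.2 - o.2) in
  let h1 := k1 - kx * s1 in let h2 := k2 - kx * s2 in
  den q != 0 -> den q' != 0 -> q' = q + s *: v -> k1 * v.1 + k2 * v.2 = 0 ->
  (h1 != 0) || (h2 != 0) -> h1 * c2 = h2 * c1 -> (c1 != 0) || (c2 != 0) ->
  exists t, projmap q' = projmap q + t *: ((- c2, c1) : plane K).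
Proof.
move=> kx h1 h2 d0 d0' Eq kv h0 hc c0.
(* Subtracting the two images over a common denominator gives s m / (den q den q'), with the vector
   [m] below. Contracting it with (h1, h2) leaves k(v) den q, which is zero. *)
pose sv := s1 * v.1 + s2 * v.2.
pose m : plane K :=
  (v.1 * den q + (q.1 - o.1) * sv, v.2 * den q + (q.2 - o.2) * sv).
have hm : h1 * m.1 + h2 * m.2 = 0.
  transitivity ((k1 * v.1 + k2 * v.2) * den q); last by rewrite kv mul0r.
  by rewrite /h1 /h2 /m /kx /sv /den /=; ring.
have cm : c1 * m.1 + c2 * m.2 = 0.
  case/orP: h0 => hn; apply: (mulfI hn); rewrite mulr0.
    transitivity (c1 * (h1 * m.1 + h2 * m.2)); last by rewrite hm mulr0.
    transitivity (c1 * h1 * m.1 + (h1 * c2) * m.2); first by ring.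
    by rewrite hc; ring.
  transitivity (c2 * (h1 * m.1 + h2 * m.2)); last by rewrite hm mulr0.
  transitivity ((h2 * c1) * m.1 + c2 * h2 * m.2); first by ring.
  by rewrite -hc; ring.
have [t mt] := orthogonal_colinear c0 cm.
exists (s * (den q)^-1 * (den q')^-1 * t).
rewrite -scalerA -mt.
have q1 : q'.1 = q.1 + s * v.1 by rewrite Eq.
have q2 : q'.2 = q.2 + s * v.2 by rewrite Eq.
have d1 : den q' = den q - s * sv by rewrite /den q1 q2 /sv; ring.
rewrite d1 in d0' *; rewrite /projmap d1 q1 q2.
rewrite -[_ *: m]/(s / den q / (den q - s * sv) * m.1,
  s / den q / (den q - s * sv) * m.2).
rewrite -[RHS]/((q.1 - o.1) / den q + s / den q / (den q - s * sv) * m.1,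
   (q.2 - o.2) / den q + s / den q / (den q - s * sv) * m.2) /m /=.
move: (den q) d0 d0' => L L0 L0'.
by congr pair; field; rewrite L0 L0'.
Qed.

End ProjectiveMap.

(** * Webs with constant basic invariant *)

Section WebForms.
Variable K : numFieldType.
Variables (D : set (plane K)) (X : 'I_4 -> set (set (plane K))) (a : K).

(* X c is defined by x w0 + y w1 = 0 with (x, y) = web_coef c. *)
Definition web_coef (c : 'I_4) : K * K :=
  nth (a, 1) [:: (1, 0); (0, 1); (1, 1)] c.

(** The index 3 falls on the [nth] default [(a, 1)], whose second entry is nonzero for every [a]. *)
Lemma web_coef_neq0 c : (web_coef c).1 = 0 -> (web_coef c).2 = 0 -> False.
Proof.
have n10 : (1 : K) <> 0 by move/eqP; rewrite oner_eq0.
by case: c => -[|[|[|[|//]]]] ?; rewrite /web_coef /= => h h'; try exact: n10 h;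
  exact: n10 h'.
Qed.

(** The third form is -(w0 + w1) by normalization and the fourth is -(a w0 + w1) by the invariant;
    [setE] absorbs the signs, which do not affect kernels. *)
Lemma basic_invariant_tangent : basic_invariant D X (fun=> a) ->
  exists w0 w1 : one_form K, [/\ smooth D w0, smooth D w1 &
    forall c L p, X c L -> L p -> D p -> tangent L p =
      [set v | (web_coef c).1 * pairing w0 p v
        + (web_coef c).2 * pairing w1 p v = 0]].
Proof.
move=> [w [w4 [[wdef wsum] [_ w4T] Ea]]]; exists (w 0), (w 1).
split; [by have [] := wdef 0|by have [] := wdef 1|move=> c L p].
have setE (f f' : plane K -> K) (r : K) : r != 0 -> (forall v, f' v = r * f v) ->
    [set v | f v = 0] = [set v | f' v = 0].
  move=> r0 ff; apply/seteqP; split=> v /=; rewrite ff.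
    by move=> ->; rewrite mulr0.
  by move/eqP; rewrite mulf_eq0 (negPf r0) => /eqP.
have n1 : (-1 : K) != 0 by rewrite oppr_eq0 oner_eq0.
have [i ->|->] := unliftP ord_max c; last first.
  move=> XL Lp Dp; rewrite (w4T _ _ XL Lp); apply: (setE _ _ _ n1) => v.
  have e := Ea p Dp; have /= e1 := congr1 fst e; have /= e2 := congr1 snd e.
  rewrite /web_coef /pairing /=; move: e1 e2; rewrite /GRing.scale /=.
  move: (w4 p) (w 0 p) (w 1 p) => [? ?] [? ?] [? ?] /= e1 e2.
  by rewrite mulN1r opprD -!mulNr e1 e2; ring.
move=> XL Lp Dp; have [_ wT] := wdef i; rewrite (wT _ _ XL Lp).
have := wsum p Dp; rewrite !big_ord_recl big_ord0 addr0 => e.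
have /= e1 := congr1 fst e; have /= e2 := congr1 snd e; move: e1 e2.
case: i {XL wT} => -[|[|[|//]]] hi.
- rewrite (_ : Ordinal hi = 0); last exact/val_inj.
  by move=> _ _; apply: (setE _ _ _ (oner_neq0 K)) => v; rewrite /web_coef /=; ring.
- rewrite (_ : Ordinal hi = 1); last exact/val_inj.
  by move=> _ _; apply: (setE _ _ _ (oner_neq0 K)) => v; rewrite /web_coef /=; ring.
rewrite (_ : lift ord0 (lift ord0 ord0) = Ordinal hi); last exact/val_inj.
rewrite (_ : lift ord0 ord0 = 1); last exact/val_inj.
rewrite (_ : ord0 = 0)//.
move=> e1 e2; apply: (setE _ _ _ n1) => v; rewrite /web_coef /pairing /=.
move: (w (Ordinal hi) p) (w 0 p) (w 1 p) e1 e2 => [x1 x2] [y1 y2] [z1 z2] /= e1 e2.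
have -> : x1 = - (y1 + z1).
  by apply/eqP; rewrite -addr_eq0 -[X in _ == X]e1; apply/eqP; ring.
have -> : x2 = - (y2 + z2).
  by apply/eqP; rewrite -addr_eq0 -[X in _ == X]e2; apply/eqP; ring.
by ring.
Qed.

(** Each failure makes two of the four kernels at [p] coincide, against the distinct tangents of a
    web: a = 0 merges the second and fourth foliations, a = 1 the third and fourth, and dependent
    forms merge two of the first three. *)
Lemma web4_independent (w0 w1 : one_form K) p : web4 D X -> D p ->
  (forall c L p, X c L -> L p -> D p -> tangent L p =
    [set v | (web_coef c).1 * pairing w0 p v
      + (web_coef c).2 * pairing w1 p v = 0]) ->
  [/\ a != 0, a != 1 & (w0 p).1 * (w1 p).2 - (w0 p).2 * (w1 p).1 != 0].
Proof.
move=> [oD cD fX tX _] Dp T.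
pose S c := [set v | (web_coef c).1 * pairing w0 p v
  + (web_coef c).2 * pairing w1 p v = 0].
have leaf c : exists2 L, X c L & L p.
  by have [[cF _ _] _ _] := fX c; move: Dp; rewrite -cF => -[L XL Lp]; exists L.
have SS c d : c != d -> S c <> S d.
  move=> cd; have [L XL Lp] := leaf c; have [M XM Mp] := leaf d.
  have := tX c d L M p cd XL XM Lp Mp.
  by rewrite (T _ _ _ XL Lp Dp) (T _ _ _ XM Mp Dp).
pose i0 : 'I_4 := @Ordinal 4 0 isT; pose i1 : 'I_4 := @Ordinal 4 1 isT.
pose i2 : 'I_4 := @Ordinal 4 2 isT; pose i3 : 'I_4 := @Ordinal 4 3 isT.
split.
- by apply/eqP => a0; apply: (SS i1 i3) => //; rewrite /S /web_coef /= a0.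
- by apply/eqP => a1; apply: (SS i2 i3) => //; rewrite /S /web_coef /= a1.
apply/eqP => d0.
have [w00|w00] := eqVneq (w0 p : plane K) 0.
  apply: (SS i1 i2) => //; rewrite /S /web_coef /=; apply/seteqP.
  by split=> v /=; rewrite /pairing w00 /= !mul0r !addr0 mulr0 mul1r.
have [|k wk] := @colinear K (w0 p) (w1 p) w00; first exact: subr0_eq.
have wv v : pairing w1 p v = k * pairing w0 p v.
  by rewrite /pairing wk -[k *: w0 p]/(k * (w0 p).1, k * (w0 p).2) /=; ring.
have [k0|k0] := eqVneq k 0.
  apply: (SS i0 i2) => //; rewrite /S /web_coef /=; apply/seteqP.
  by split=> v /=; rewrite wv k0 !mul0r !mulr0.
apply: (SS i0 i1) => //; rewrite /S /web_coef /=; apply/seteqP.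
split=> v /=; rewrite wv !mul1r !mul0r ?addr0 ?add0r.
  by move=> ->; rewrite mulr0.
by move/eqP; rewrite mulf_eq0 (negPf k0) => /eqP.
Qed.

End WebForms.

Lemma bending_congr (K : fieldType) (k1 k2 k11 k12 k21 k22 x11 x12 x21 x22 : K) :
  k11 = x11 -> k12 = x12 -> k21 = x21 -> k22 = x22 ->
  bending k1 k2 k11 k12 k21 k22 = 0 -> bending k1 k2 x11 x12 x21 x22 = 0.
Proof. by move=> -> -> -> ->. Qed.

Section ProjectiveCoefficients.
Variables (K : numFieldType) (D : set (plane K)) (oD : open D).
Implicit Types k : plane K -> K.

Lemma smooth_bil (u1 u2 v1 v2 k11 k12 k21 k22 : plane K -> K) :
  smooth D u1 -> smooth D u2 -> smooth D v1 -> smooth D v2 ->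
  smooth D k11 -> smooth D k12 -> smooth D k21 -> smooth D k22 ->
  smooth D (fun q : plane K => bil (u1 q, u2 q) (v1 q, v2 q)
    (k11 q) (k12 q) (k21 q) (k22 q)).
Proof.
move=> su1 su2 sv1 sv2 s11 s12 s21 s22.
exact: (smoothD oD (smoothD oD (smoothD oD
  (smoothM oD (smoothM oD su1 sv1) s11) (smoothM oD (smoothM oD su1 sv2) s12))
  (smoothM oD (smoothM oD su2 sv1) s21)) (smoothM oD (smoothM oD su2 sv2) s22)).
Qed.

Lemma derive_comb x y k k' v q : D q -> smooth D k -> smooth D k' ->
  'D_v (fun q => x * k q + y * k' q) q = x * 'D_v k q + y * 'D_v k' q.
Proof.
move=> Dq s s'.
have sx : smooth D (fun _ : plane K => x) by exact: smooth_cst.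
have sy : smooth D (fun _ : plane K => y) by exact: smooth_cst.
rewrite (deriveD_on _ (smoothM oD sx s) (smoothM oD sy s') Dq).
rewrite (deriveM_on _ sx s Dq) (deriveM_on _ sy s' Dq).
by rewrite (derive_cst x q v) (derive_cst y q v) !mulr0 !addr0.
Qed.

Lemma smooth_comb x y k k' : smooth D k -> smooth D k' ->
  smooth D (fun q => x * k q + y * k' q).
Proof.
move=> s s'; apply: (smoothD oD); apply: (smoothM oD) => //; exact: smooth_cst.
Qed.

Variables a1 a2 b1 b2 : plane K -> K.
Hypotheses (sa1 : smooth D a1) (sa2 : smooth D a2).
Hypotheses (sb1 : smooth D b1) (sb2 : smooth D b2).
Hypothesis ab0 : forall q, D q -> a1 q * b2 q - a2 q * b1 q != 0.

Lemma smooth_frame_coef (z w x y : plane K -> K) :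
  smooth D z -> smooth D w -> smooth D x -> smooth D y ->
  smooth D (fun q =>
    frame_coef (a1 q) (a2 q) (b1 q) (b2 q) (z q) (w q) (x q) (y q)).
Proof.
move=> sz sw sx sy.
have sdet := smoothB oD (smoothM oD sa1 sb2) (smoothM oD sa2 sb1).
apply: (smoothM oD (smoothD oD (smoothM oD sz sx) (smoothM oD sw sy))).
by apply: (smoothV oD _ (smoothM oD sdet sdet)) => q Dq; rewrite mulf_neq0// ab0.
Qed.

Local Notation D1 f := ('D_((1, 0) : plane K) f).
Local Notation D2 f := ('D_((0, 1) : plane K) f).
Variable a : K.
Hypotheses (na0 : a != 0) (na1 : a != 1).

Hypothesis bend : forall (c : 'I_4) q, D q ->
  let x := (web_coef a c).1 in let y := (web_coef a c).2 in
  bending (x * a1 q + y * b1 q) (x * a2 q + y * b2 q)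
    (x * D1 a1 q + y * D1 b1 q) (x * D1 a2 q + y * D1 b2 q)
    (x * D2 a1 q + y * D2 b1 q) (x * D2 a2 q + y * D2 b2 q) = 0.

(** The system is linear in the covector for fixed l and p, so all four foliations satisfy it and
    share one line of vertices. *)
Lemma comb_derivatives x y l1 l2 p1 p2 q : D q ->
  [/\ D1 a1 q = l1 q * a1 q + p1 q * a1 q, D1 a2 q = l1 q * a2 q + p2 q * a1 q,
      D2 a1 q = l2 q * a1 q + p1 q * a2 q & D2 a2 q = l2 q * a2 q + p2 q * a2 q] ->
  [/\ D1 b1 q = l1 q * b1 q + p1 q * b1 q, D1 b2 q = l1 q * b2 q + p2 q * b1 q,
      D2 b1 q = l2 q * b1 q + p1 q * b2 q & D2 b2 q = l2 q * b2 q + p2 q * b2 q] ->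
  let k1 q := x * a1 q + y * b1 q in let k2 q := x * a2 q + y * b2 q in
  [/\ D1 k1 q = l1 q * k1 q + p1 q * k1 q, D1 k2 q = l1 q * k2 q + p2 q * k1 q,
      D2 k1 q = l2 q * k1 q + p1 q * k2 q & D2 k2 q = l2 q * k2 q + p2 q * k2 q].
Proof.
move=> Dq [h1 h2 h3 h4] [h5 h6 h7 h8] k1 k2.
rewrite /k1 /k2 !derive_comb// h1 h2 h3 h4 h5 h6 h7 h8.
by split; ring.
Qed.

(** [covector_derivatives] works at a single point. Its formulas, spread over [D'] by [G] when
    applied to the linear web, are rational in the coefficients and their first derivatives, with
    the squared determinant as only denominator, so they are smooth. *)
Lemma straight_projective : exists l1 l2 p1 p2 : plane K -> K,
  [/\ smooth D l1, smooth D l2, smooth D p1 & smooth D p2] /\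
  forall q, D q ->
  [/\ D1 a1 q = l1 q * a1 q + p1 q * a1 q, D1 a2 q = l1 q * a2 q + p2 q * a1 q,
      D2 a1 q = l2 q * a1 q + p1 q * a2 q & D2 a2 q = l2 q * a2 q + p2 q * a2 q] /\
  [/\ D1 b1 q = l1 q * b1 q + p1 q * b1 q, D1 b2 q = l1 q * b2 q + p2 q * b1 q,
      D2 b1 q = l2 q * b1 q + p1 q * b2 q & D2 b2 q = l2 q * b2 q + p2 q * b2 q].
Proof.
pose G (f : K -> K -> K -> K -> K -> K -> K -> K -> K -> K -> K -> K -> K) q :=
  f (a1 q) (a2 q) (b1 q) (b2 q) (D1 a1 q) (D1 a2 q) (D2 a1 q) (D2 a2 q)
    (D1 b1 q) (D1 b2 q) (D2 b1 q) (D2 b2 q).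
exists (G (@lam1 K)), (G (@lam2 K)), (G (@psi1 K)), (G (@psi2 K)).
split.
  have sd k (v : plane K) : smooth D k -> smooth D ('D_v k).
    exact: smooth_derive.
  have sna2 := smoothN oD sa2; have snb1 := smoothN oD sb1.
  have sBYX := smooth_bil sna2 sa1 sb2 snb1 (sd _ (1, 0) sb1) (sd _ (1, 0) sb2)
    (sd _ (0, 1) sb1) (sd _ (0, 1) sb2).
  have sBXY := smooth_bil sb2 snb1 sna2 sa1 (sd _ (1, 0) sb1) (sd _ (1, 0) sb2)
    (sd _ (0, 1) sb1) (sd _ (0, 1) sb2).
  have sAYX := smooth_bil sna2 sa1 sb2 snb1 (sd _ (1, 0) sa1) (sd _ (1, 0) sa2)
    (sd _ (0, 1) sa1) (sd _ (0, 1) sa2).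
  have sAXY := smooth_bil sb2 snb1 sna2 sa1 (sd _ (1, 0) sa1) (sd _ (1, 0) sa2)
    (sd _ (0, 1) sa1) (sd _ (0, 1) sa2).
  split.
  - exact: (smooth_frame_coef sa1 sb1 sBXY sAYX).
  - exact: (smooth_frame_coef sa2 sb2 sBXY sAYX).
  - exact: (smooth_frame_coef sa1 sb1 sBYX sAXY).
  - exact: (smooth_frame_coef sa2 sb2 sBYX sAXY).
move=> q Dq; apply: (covector_derivatives (ab0 Dq) na0 na1).
- have := bend (@Ordinal 4 0 isT) Dq.
  by rewrite /web_coef /= !mul1r !mul0r !addr0.
- have := bend (@Ordinal 4 1 isT) Dq.
  by rewrite /web_coef /= !mul1r !mul0r !add0r.
- have := bend (@Ordinal 4 2 isT) Dq.
  by rewrite /web_coef /= !mul1r.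
- have := bend (@Ordinal 4 3 isT) Dq.
  by rewrite /web_coef /= !mul1r.
Qed.

End ProjectiveCoefficients.

Lemma neq0_or (K : fieldType) (x y : K) :
  (x = 0 -> y = 0 -> False) -> (x != 0) || (y != 0).
Proof.
move=> h; have [x0|//] := eqVneq x 0.
by apply/negP => /eqP; exact: h.
Qed.

(** An empty domain offers no base point for the projective map; but it has no leaves either, since
    leaves are nonempty. *)
Lemma empty_parallelizable (K : numFieldType) (X : 'I_4 -> set (set (plane K))) :
  web4 set0 X -> parallelizable set0 X.
Proof.
move=> webX; have [_ _ fX _ _] := webX; exists set0, X; split=> //.
  move=> c; exists (1, 0).
    by apply/eqP => -[/eqP]; rewrite oner_eq0.
  move=> L XL; have [[_ _ /(_ L XL) [p Lp]] _ _] := fX c.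
  by have := foliation_subset (fX c) XL Lp.
exists id; split; first exact: diffeo_id.
move=> c; apply/seteqP; split=> [L XL|_ [L XL <-]]; last by rewrite image_id.
by exists L => //; rewrite image_id.
Qed.

(** * From a linear web to a parallel one *)

Section Main.
Variables (R : realType) (K : numFieldType) (e : real_parts R K).
Variables (D : set (plane K)) (X : 'I_4 -> set (set (plane K))) (a : K).

Lemma constant_linear_parallelizable : web4 D X -> basic_invariant D X (fun=> a) ->
  linearizable D X -> parallelizable D X.
Proof.
move=> webX /basic_invariant_tangent[w0 [w1 [sw0 sw1 wT]]].
move=> [D' [X' [webX' linX' [phi [dphi EX']]]]].
have [D0|/set0P[p0 Dp0]] := eqVneq D set0.
  by rewrite D0 in webX *; exact: empty_parallelizable.
have [oD _ fX _ _] := webX; have [oD' cD' _ _ _] := webX'.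
have XD c L : X c L -> L `<=` D by exact: foliation_subset (fX c).
have wT' c L p : X c L -> L p -> _ := fun XL Lp => wT c L p XL Lp (XD c L XL p Lp).
have [sphi [g [sg phiK gK]]] := (diffeoP _ _ _).1 dphi.
have lin c L : X c L -> exists p v, v != 0 /\ phi @` L `<=` line p v.
  by move=> XL; apply: (linX' c); rewrite EX'; exists L.
have ind p (Dp : D p) := web4_independent webX Dp wT.
have [na0 na1 _] := ind p0 Dp0.
pose a1 := pull g w0 (1, 0); pose a2 := pull g w0 (0, 1).
pose b1 := pull g w1 (1, 0); pose b2 := pull g w1 (0, 1).
have sp w v : smooth D w -> smooth D' (pull g w v) := smooth_pull oD oD' sg gK v.
have sa1 : smooth D' a1 by exact: sp.
have sa2 : smooth D' a2 by exact: sp.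
have sb1 : smooth D' b1 by exact: sp.
have sb2 : smooth D' b2 by exact: sp.
have ab0 q : D' q -> a1 q * b2 q - a2 q * b1 q != 0.
  move=> Dq; have [Dgq _] := gK _ Dq; have [_ _ d0] := ind _ Dgq.
  exact: (pull_det oD' sphi sg gK).
have coef0 c q : D' q ->
    ((web_coef a c).1 * a1 q + (web_coef a c).2 * b1 q != 0)
    || ((web_coef a c).1 * a2 q + (web_coef a c).2 * b2 q != 0).
  move=> Dq; apply: neq0_or => h1 h2.
  have d0 : a1 q * b2 q - b1 q * a2 q != 0 by rewrite [b1 q * _]mulrC ab0.
  have [h h'] := det2_eq0 d0 h1 h2; exact: web_coef_neq0 h h'.
have leaf c q : D' q -> exists2 L, X c L & L (g q).
  move=> /gK[Dg _]; have [[cF _ _] _ _] := fX c.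
  by move: Dg; rewrite -cF => -[L XL Lq]; exists L.
have bend (c : 'I_4) q : D' q ->
    let x := (web_coef a c).1 in let y := (web_coef a c).2 in
    bending (x * a1 q + y * b1 q) (x * a2 q + y * b2 q)
    (x * 'D_(1, 0) a1 q + y * 'D_(1, 0) b1 q)
    (x * 'D_(1, 0) a2 q + y * 'D_(1, 0) b2 q)
    (x * 'D_(0, 1) a1 q + y * 'D_(0, 1) b1 q)
    (x * 'D_(0, 1) a2 q + y * 'D_(0, 1) b2 q) = 0.
  move=> Dq x y; have [L XL Lq] := leaf c q Dq; have [Dg gq] := gK _ Dq.
  have := bending_leaf oD oD' sphi sg phiK gK sw0 sw1 (XD c) (wT' c) (lin c) XL Lq.
  rewrite gq => /(_ (coef0 c q Dq)).
  have d z v := derive_comb oD' x y v Dq (sp _ z sw0) (sp _ z sw1).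
  exact: (bending_congr (d (1, 0) (1, 0)) (d (0, 1) (1, 0))
    (d (1, 0) (0, 1)) (d (0, 1) (0, 1))).
have [l1 [l2 [p1 [p2 [[sl1 sl2 sp1 sp2] dab]]]]] :=
  straight_projective oD' sa1 sa2 sb1 sb2 ab0 na0 na1 bend.
have dp q := @psi_derivatives _ _ e _ oD' _ _ _ _ _ _ _ _ sa1 sa2 sb1 sb2
  sl1 sl2 sp1 sp2 ab0 (fun q Dq => (dab q Dq).1) (fun q Dq => (dab q Dq).2) q.
pose q0 := phi p0; have Dq0 : D' q0 by have [] := phiK _ Dp0.
have den0 q := @denominator_neq0 _ _ e _ _ oD' cD' Dq0 _ _ sp1 sp2 dp q.
pose U := [set q | denominator q0 p1 p2 q != 0].
have dpsi := diffeo_projmap q0 (p1 q0) (p2 q0).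
pose psi := projmap q0 (p1 q0) (p2 q0).
(* The projective map is a diffeomorphism off the line of vertices, and the linear web lives
   entirely there, so its domain need not be shrunk. *)
have D'U : D' `<=` U by exact: den0.
have dpsi' : diffeo D' (psi @` D') psi := diffeo_subset D'U dpsi.
have oD'' : open (psi @` D').
  exact: diffeo_open D'U oD' (@open_iden K (p1 q0) (p2 q0)) dpsi.
exists (psi @` D'), (fun c => (fun L => (psi \o phi) @` L) @` X c).
have dcomp := diffeo_comp oD oD' oD'' dphi dpsi'.
split; [exact: diffeo_web4 dcomp webX| |by exists (psi \o phi)].
move=> c; pose x := (web_coef a c).1; pose y := (web_coef a c).2.
pose k1 q := x * a1 q + y * b1 q; pose k2 q := x * a2 q + y * b2 q.
have k0 q : D' q -> (k1 q != 0) || (k2 q != 0) by exact: coef0.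
have sk1 : smooth D' k1 := smooth_comb oD' x y sa1 sb1.
have sk2 : smooth D' k2 := smooth_comb oD' x y sa2 sb2.
have dk q (Dq : D' q) := comb_derivatives oD' sa1 sa2 sb1 sb2 x y Dq
  (dab q Dq).1 (dab q Dq).2.
(* The normals of the image leaves are proportional to their common value at [q0], where the image
   form is (k1, k2); this is the direction that it annihilates. *)
exists (- k2 q0, k1 q0).
  apply: contraL (k0 _ Dq0) => /eqP[/eqP]; rewrite oppr_eq0 => /eqP-> ->.
  by rewrite eqxx.
move=> _ [L XL <-]; have [[_ _ /(_ L XL)[p Lp]] _ _] := fX c.
have Dp := XD c L XL p Lp; have [Dq gq] := phiK _ Dp.
have [r [v [v0 Lrv]]] := lin c L XL.
have [kv _] := leaf_direction oD sphi sg phiK (XD c) (wT' c) XL v0 Lrv Lp.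
exists (psi (phi p)) => _ [p' Lp' <-] /=.
have [Dq' gq'] := phiK _ (XD c L XL p' Lp').
have [s Es] := Lrv _ (imageP phi Lp); have [s' Es'] := Lrv _ (imageP phi Lp').
have E : phi p' = phi p + (s' - s) *: v.
  by rewrite Es Es' -addrA -scalerDl [s + _]addrC subrK.
exact: (projmap_line (den0 _ Dq) (den0 _ Dq') E kv
  (image_form_neq0 e oD' cD' Dq0 sp1 sp2 dp k0 Dq)
  (image_form_direction e oD' cD' Dq0 sp1 sp2 dp sk1 sk2 dk k0 Dq) (k0 _ Dq0)).
Qed.

End Main.

Theorem theorem16 (R : realType) (k : ground_field)
    (D : set (plane (base_field R k)))
    (X : 'I_4 -> set (set (plane (base_field R k)))) :
  webNW D X -> linearizable D X -> parallelizable D X.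
Proof.
(* The real and the complex case part only here, in the choice of real components. *)
have e : real_parts R (base_field R k).
  by case: k {D X} => /=; [exact: real_real_parts|exact: complex_real_parts].
by move=> [webX [a Xa] _]; exact: constant_linear_parallelizable e _ _ a webX Xa.
Qed.
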